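(* Let $\pi(x)$ denote the number of primes $\le x$ and $\pi_{RPR}(x)$ the number of RPR-primes $\le x$. Then $$\liminf_{x\to\infty}\frac{\pi_{RPR}(x)}{\pi(x)}\ \ge\ \frac12 .$$
   Context: A prime $p$ is an RPR-prime if, with $q$ the smallest prime greater than $p/2$, the open interval $(p,2q)$ contains a prime. (For odd $p=p_n$, $p_k$ the $k$-th prime, this is equivalent to all integers $\frac{p+1}{2},\frac{p+3}{2},\dots,\frac{p_{n+1}-1}{2}$ being composite.) *)

(* Defs.v *)
From mathcomp Require Import all_boot all_order all_algebra.
From mathcomp Require Import all_classical all_reals all_analysis.
Set Implicit Arguments. Unset Strict Implicit. Unset Printing Implicit Defensive.

(* q_of p = the smallest prime q with q > p/2, i.e. p < 2q.  For p >= 1 such a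
   q exists and is <= p when p is prime (p itself qualifies), so the search
   over 0..p is exhaustive for prime p; the default p.+1 is never used then. *)
Definition q_of (p : nat) : nat :=
  head p.+1 [seq q <- iota 0 p.+1 | prime q && (p < q.*2)].

Definition rpr_prime (p : nat) : bool :=
  prime p && has (fun r => prime r && (p < r) && (r < (q_of p).*2)) (iota 0 (q_of p).*2).

Definition prime_pi (n : nat) : nat := count prime (iota 0 n.+1).
Definition rpr_pi (n : nat) : nat := count rpr_prime (iota 0 n.+1).

(* Main.v *)
(* A prime p that is not an RPR-prime is followed, before the next prime, by some
   2q with q prime, and different p use different q.  Hence
   pi(x) - pi_RPR(x) <= pi(x/2) + 1, and the bound 1/2 follows from
   pi(x/2) <= (1/2 + o(1)) pi(x), a consequence of the prime number theorem.

   The prime number theorem, in the form psi(n) - n = o(n), is proved by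
   Selberg's elementary method.  With R(n) = psi(n) - n, the Tatuzawa-Iseki
   inversion applied to psi(y) - y + gamma + 1 gives Selberg's formula
   R(N) log N + sum_(m <= N) Lambda(m) R(N/m) = O(N); iterating it yields
   |R(N)| log^2 N <= 2 sum_(k <= N) |R(N/k)| log k + O(N log N).
   Since sum R(n)/n(n+1) is bounded, |R(n)| <= delta n for some n in every
   interval [y, K y], and Selberg's formula propagates this to a whole interval
   [n, (1 + 1/k) n].  A positive proportion of the weights (log i)/i falls on such
   intervals, so an eventual bound |R(n)| <= b n always improves to
   |R(n)| <= (b - c) n, with c depending only on a lower bound for b.

   All sums run over natural numbers and N/m is the truncated quotient N %/ m,
   which satisfies (N %/ m) %/ n = N %/ (m * n). *)
Require Import Defs.
From mathcomp Require Import all_boot all_order all_algebra.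
From mathcomp Require Import all_classical all_reals all_analysis.
From mathcomp Require Import ring lra zify.
Set Implicit Arguments. Unset Strict Implicit. Unset Printing Implicit Defensive.
Import Order.TTheory GRing.Theory Num.Theory.
Local Open Scope ring_scope.

(** * The von Mangoldt and Moebius functions *)

(** [primes n] lists the prime divisors without repetition, so it has a single entry exactly when
    [n] is a positive power of a prime. *)
Definition vonMangoldt {R : realType} (n : nat) : R :=
  if primes n is [:: p] then ln p%:R else 0.

(** The test on exponents says that [n] is squarefree. At [n = 0] the value is 1, but every sum
    below runs over positive indices. *)
Definition moebius {R : realType} (n : nat) : R :=
  if all (fun p => logn p n <= 1)%N (primes n) then (-1) ^+ size (primes n)
  else 0.

Section Arith.
Variable R : realType.
Local Notation Lam := (@vonMangoldt R).
Local Notation mu := (@moebius R).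
Implicit Types (n m d e p N : nat).

(** * Sums over multiples and divisors *)

Lemma sum_multiples (F : nat -> R) d N : (0 < d)%N ->
  \sum_(1 <= m < N.+1 | (d %| m)%N) F (m %/ d)%N =
  \sum_(1 <= k < (N %/ d).+1) F k.
Proof.
move=> d0; elim: N => [|N IH]; first by rewrite div0n !big_geq.
rewrite big_mkcond big_nat_recr//= -big_mkcond/= IH divnS//.
case: (boolP (d %| N.+1)%N) => dN; last by rewrite addr0 add0n.
by rewrite add1n [RHS]big_nat_recr.
Qed.

Lemma sum_div_exchange (F : nat -> nat -> R) N :
  \sum_(1 <= d < N.+1) \sum_(1 <= k < (N %/ d).+1) F d k =
  \sum_(1 <= m < N.+1) \sum_(1 <= d < N.+1 | (d %| m)%N) F d (m %/ d)%N.
Proof.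
rewrite [RHS](exchange_big_dep_nat xpredT)//=.
rewrite big_nat_cond [RHS]big_nat_cond; apply: eq_bigr => d.
by rewrite andbT => /andP[d0 _]; rewrite -(@sum_multiples (F d)).
Qed.

Lemma sum_divisors (F : nat -> R) n N : (0 < n <= N)%N ->
  \sum_(1 <= d < N.+1 | (d %| n)%N) F d = \sum_(d <- divisors n) F d.
Proof.
move=> /andP[n0 nN]; rewrite -big_filter; apply: perm_big; apply: uniq_perm.
- by rewrite filter_uniq// iota_uniq.
- exact: divisors_uniq.
move=> d; rewrite mem_filter mem_index_iota -dvdn_divisors//.
case: (boolP (d %| n)%N) => //= dn; rewrite ltnS (dvdn_gt0 n0 dn)/=.
exact: leq_trans (dvdn_leq n0 dn) nN.
Qed.

(** Induction step for the divisor sums below, removing one prime factor [p]: a divisor of [p * n]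
    prime to [p] divides [n] by Gauss's lemma, and any other is [p * e] with [e] dividing [n]. *)
Lemma divisors_prime_split (F : nat -> R) p n : prime p -> (0 < n)%N ->
  \sum_(d <- divisors (p * n)) F d =
  \sum_(e <- divisors n | ~~ (p %| e)%N) F e +
  \sum_(e <- divisors n) F (p * e)%N.
Proof.
move=> pp n0; have p0 := prime_gt0 pp.
have pn0 : (0 < p * n)%N by rewrite muln_gt0 p0.
rewrite (bigID (fun d => p %| d)%N)/= addrC; congr (_ + _).
  rewrite -!(big_filter (divisors _)); apply: perm_big; apply: uniq_perm.
  - by rewrite filter_uniq// divisors_uniq.
  - by rewrite filter_uniq// divisors_uniq.
  move=> d; rewrite !mem_filter -!dvdn_divisors//.
  case: (boolP (p %| d)%N) => //= pd.
  by rewrite Gauss_dvdr// coprime_sym prime_coprime.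
rewrite -big_filter -(big_map (muln p) xpredT).
apply: perm_big; apply: uniq_perm.
- by rewrite filter_uniq// divisors_uniq.
- by rewrite map_inj_uniq ?divisors_uniq// => a b /eqP; rewrite eqn_pmul2l// => /eqP.
move=> d; rewrite mem_filter -dvdn_divisors//; apply/andP/mapP.
  move=> [/dvdnP[e ->]]; rewrite mulnC dvdn_pmul2l// => en.
  by exists e => //; rewrite -dvdn_divisors.
by move=> [e]; rewrite -dvdn_divisors// => en ->; rewrite dvdn_mulr// dvdn_pmul2l.
Qed.

Lemma primes_mul_dvd p e : prime p -> (0 < e)%N -> (p %| e)%N ->
  primes (p * e) = primes e.
Proof.
move=> pp e0 pe; apply/eq_primes => q.
rewrite primesM ?(prime_gt0 pp)//.
rewrite primes_prime// inE.
by case: eqP => // ->; rewrite mem_primes pp e0 pe.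
Qed.

Lemma primes_mul_ndvd p e : prime p -> (0 < e)%N -> ~~ (p %| e)%N ->
  perm_eq (primes (p * e)) (p :: primes e).
Proof.
move=> pp e0 pe; apply: uniq_perm; first exact: primes_uniq.
  by rewrite /= primes_uniq mem_primes (negbTE pe) !andbF.
by move=> q; rewrite primesM ?(prime_gt0 pp)// primes_prime// !inE.
Qed.

Lemma vonMangoldt_primeM_dvd p e : prime p -> (0 < e)%N -> (p %| e)%N ->
  Lam (p * e) = Lam e.
Proof. by move=> pp e0 pe; rewrite /vonMangoldt primes_mul_dvd. Qed.

Lemma vonMangoldt_prime p : prime p -> Lam p = ln p%:R.
Proof. by move=> pp; rewrite /vonMangoldt primes_prime. Qed.

Lemma vonMangoldt_primeM_ndvd p e : prime p -> (1 < e)%N -> ~~ (p %| e)%N ->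
  Lam (p * e) = 0.
Proof.
move=> pp e1 pe; have e0 : (0 < e)%N by exact: ltnW.
have := perm_size (primes_mul_ndvd pp e0 pe).
have : primes e != [::] by rewrite primes_eq0 -leqNgt.
rewrite /vonMangoldt; case: (primes (p * e)) => [|a [|b s]] //=.
by case: (primes e).
Qed.

Lemma vonMangoldt_ge0 n : 0 <= Lam n.
Proof.
rewrite /vonMangoldt; case E : (primes n) => [|p [|? ?]] //.
apply: ln_ge0; rewrite ler1n.
have : p \in primes n by rewrite E mem_head.
by rewrite mem_primes => /andP[/prime_gt0].
Qed.

Lemma vonMangoldt_le_ln n : Lam n <= ln n%:R.
Proof.
case: n => [|n]; first by rewrite /vonMangoldt/= ln0.
rewrite /vonMangoldt; case E : (primes _) => [|p [|? ?]] //; rewrite ?ln_ge0 ?ler1n//.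
have : p \in primes n.+1 by rewrite E mem_head.
rewrite mem_primes => /andP[/prime_gt0 p0 /andP[_ pn]].
by rewrite ler_ln ?posrE ?ltr0n// ler_nat dvdn_leq.
Qed.

(** Write [n = p * m] with [p] the least prime factor. Passing from [m] to [n], the terms
    [Lam (p * e)] repeat [Lam e] when [p] divides [e] and vanish otherwise, except for [e = 1],
    which contributes [ln p]. *)
Lemma sum_vonMangoldt_divisors n : (0 < n)%N ->
  \sum_(d <- divisors n) Lam d = ln n%:R.
Proof.
elim/ltn_ind: n => n IH n0; have [n1|n1] := leqP n 1.
  have -> : n = 1%N by apply/eqP; rewrite eqn_leq n1.
  by rewrite big_seq1 ln1.
have pp := pdiv_prime n1; set p := pdiv n in pp.
have /dvdnP[m nE] : (p %| n)%N by exact: pdiv_dvd.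
rewrite mulnC in nE; have m0 : (0 < m)%N by move: n0; rewrite nE muln_gt0 => /andP[].
have mn : (m < n)%N by rewrite nE ltn_Pmull// prime_gt1.
rewrite nE divisors_prime_split// natrM lnM ?posrE ?ltr0n ?(prime_gt0 pp)//.
rewrite -(IH m)// [in RHS](bigID (fun d => p %| d)%N)/= [LHS]addrC addrA.
congr (_ + _); rewrite (bigD1_seq 1%N) ?divisors_uniq -?dvdn_divisors ?dvd1n//=.
rewrite muln1 vonMangoldt_prime//; congr (_ + _).
rewrite big_mkcond [RHS]big_mkcond; apply: eq_big_seq => d.
rewrite -dvdn_divisors// => dm; have d0 := dvdn_gt0 m0 dm.
have [->|d1] := eqVneq d 1%N; first by rewrite dvdn1 gtn_eqF ?(prime_gt1 pp).
case: ifP => pd; first exact: vonMangoldt_primeM_dvd.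
by apply: vonMangoldt_primeM_ndvd => //; rewrite ?pd// ltn_neqAle eq_sym d1.
Qed.

Lemma moebius_primeM_dvd p e : prime p -> (0 < e)%N -> (p %| e)%N ->
  mu (p * e) = 0.
Proof.
move=> pp e0 pe; rewrite /moebius primes_mul_dvd// ifF//.
apply/negP => /allP/(_ p); rewrite mem_primes pp e0 pe => /(_ isT).
rewrite lognM ?(prime_gt0 pp)// logn_prime// eqxx add1n ltnS leqn0.
by apply/negP; rewrite -lt0n logn_gt0 mem_primes pp e0.
Qed.

Lemma moebius_primeM_ndvd p e : prime p -> (0 < e)%N -> ~~ (p %| e)%N ->
  mu (p * e) = - mu e.
Proof.
move=> pp e0 pe; have P := primes_mul_ndvd pp e0 pe.
rewrite /moebius (perm_all _ P) (perm_size P)/= lognM ?(prime_gt0 pp)//.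
rewrite logn_prime// eqxx lognE pp e0 (negbTE pe) addn0 leqnn/=.
rewrite (_ : all _ (primes e) = all (fun q => (logn q e <= 1)%N) (primes e)).
  by case: ifP => _; rewrite ?oppr0// exprS mulN1r.
apply: eq_in_all => q; rewrite mem_primes => /andP[qp /andP[_ qe]].
rewrite lognM ?(prime_gt0 pp)// logn_prime//.
by case: eqP => // qpE; rewrite -qpE qe in pe.
Qed.

Lemma moebius_norm_le1 n : `|mu n| <= 1.
Proof.
by rewrite /moebius; case: ifP => _; rewrite ?normr0// normrX normrN1 expr1n.
Qed.

(** For a prime factor [p] of [n], the terms at [e] and [p * e] cancel when [p] does not divide [e];
    the others vanish. *)
Lemma sum_moebius_divisors n : (0 < n)%N ->
  \sum_(d <- divisors n) mu d = (n == 1%N)%:R.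
Proof.
move=> n0; have [->|n1] := eqVneq n 1%N; first by rewrite big_seq1 /moebius /= expr0.
have {}n1 : (1 < n)%N by rewrite ltn_neqAle eq_sym n1.
have pp := pdiv_prime n1; set p := pdiv n in pp.
have /dvdnP[m nE] : (p %| n)%N by exact: pdiv_dvd.
rewrite mulnC in nE; have m0 : (0 < m)%N by move: n0; rewrite nE muln_gt0 => /andP[].
rewrite nE divisors_prime_split// big_mkcond -big_split/= big_seq big1// => e.
rewrite -dvdn_divisors// => em; have e0 := dvdn_gt0 m0 em.
have [pe|pe] := boolP (p %| e)%N; first by rewrite moebius_primeM_dvd// addr0.
by rewrite moebius_primeM_ndvd// subrr.
Qed.

Lemma sum_moebius_ln_divisors n : (0 < n)%N ->
  \sum_(d <- divisors n) mu d * ln d%:R = - Lam n.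
Proof.
move=> n0; have [->|n1] := eqVneq n 1%N.
  by rewrite big_seq1 ln1 mulr0 /vonMangoldt/= oppr0.
have {}n1 : (1 < n)%N by rewrite ltn_neqAle eq_sym n1.
have pp := pdiv_prime n1; have pn := pdiv_dvd n; set p := pdiv n in pp pn.
have /dvdnP[m nE] := pn.
rewrite mulnC in nE; have m0 : (0 < m)%N by move: n0; rewrite nE muln_gt0 => /andP[].
rewrite {1}nE divisors_prime_split// big_mkcond -big_split/=.
(* The pair [e], [p * e] with [e] prime to [p] leaves [- ln p * mu e], and such [e] are the divisors
   of the [p']-part of [n]. The Moebius sum over them is 1 exactly when [n] is a power of [p]. *)
transitivity (- ln p%:R * \sum_(e <- divisors n`_p^') mu e).
  rewrite mulr_sumr; transitivity (\sum_(e <- divisors m | ~~ (p %| e)%N) - ln p%:R * mu e).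
    rewrite [RHS]big_mkcond; apply: eq_big_seq => e.
    rewrite -dvdn_divisors// => em; have e0 := dvdn_gt0 m0 em.
    have [pe|pe] := boolP (p %| e)%N.
      by rewrite moebius_primeM_dvd//= mul0r addr0.
    by rewrite moebius_primeM_ndvd//= natrM lnM ?posrE ?ltr0n ?(prime_gt0 pp)//; ring.
  rewrite -big_filter; apply: perm_big; apply: uniq_perm.
  - by rewrite filter_uniq// divisors_uniq.
  - exact: divisors_uniq.
  move=> e; rewrite mem_filter -!dvdn_divisors ?part_gt0//.
  apply/andP/idP => [[pe em]|en].
    have en : (e %| n)%N by rewrite nE dvdn_mull.
    rewrite -(part_pnat_id (_ : p^'.-nat e)%N) ?partn_dvd//.
    by rewrite p'natE.
  have e0 := dvdn_gt0 (part_gt0 p^' n) en.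
  have pe : ~~ (p %| e)%N by rewrite -p'natE//; apply: pnat_dvd en (part_pnat _ _).
  split => //; rewrite -(@Gauss_dvdr _ p) -?nE; last by rewrite coprime_sym prime_coprime.
  by apply: dvdn_trans en (dvdn_part _ _).
rewrite sum_moebius_divisors ?part_gt0// /vonMangoldt mulNr; congr (- _).
have pin : p \in primes n by rewrite mem_primes pp n0.
have -> : (n`_p^' == 1)%N = (primes n == [:: p]).
  apply/idP/eqP => [/eqP np|nE'].
    have -> : n = (p ^ logn p n)%N by rewrite -p_part -[LHS](partnC p n0) np muln1.
    by rewrite primesX ?logn_gt0// primes_prime.
  by rewrite partn_eq1// /pnat n0 nE'/= andbT negnK inE/=.
move: pin; case: (primes n) => [|a [|b s]] //=; first by rewrite inE => /eqP ->; rewrite eqxx mulr1.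
by rewrite eqseq_cons /= andbF mulr0.
Qed.

End Arith.

(** * Chebyshev and Mertens estimates *)

Definition chebyshev_psi {R : realType} (N : nat) : R :=
  \sum_(1 <= n < N.+1) vonMangoldt n.

Definition log_sum {R : realType} (N : nat) : R := \sum_(1 <= n < N.+1) ln n%:R.

Definition harmonic_sum {R : realType} (N : nat) : R :=
  \sum_(1 <= n < N.+1) n%:R^-1.

Section Cheb.
Variable R : realType.
Local Notation Lam := (@vonMangoldt R).
Local Notation psi := (@chebyshev_psi R).
Local Notation T := (@log_sum R).
Local Notation H := (@harmonic_sum R).
Local Notation L n := (@ln R n%:R).
Implicit Types (n m d e p N M : nat).

(** * Elementary bounds for logarithms and their sums *)

Lemma ln_diff_le (x y : R) : 0 < x -> 0 < y -> ln y - ln x <= (y - x) / x.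
Proof.
move=> x0 y0; rewrite -ln_div ?posrE//.
have -> : y / x = 1 + (y - x) / x by field; rewrite gt_eqF.
apply: le_ln1Dx; have := divr_gt0 y0 x0.
have -> : y / x = 1 + (y - x) / x by field; rewrite gt_eqF.
lra.
Qed.

Lemma ln_nat_ge0 n : 0 <= L n.
Proof. by case: n => [|n]; [rewrite ln0|rewrite ln_ge0// ler1n]. Qed.

Lemma ler_ln_nat n m : (n <= m)%N -> L n <= L m.
Proof.
case: n => [|n nm]; first by rewrite ln0// ln_nat_ge0.
by rewrite ler_ln ?posrE ?ltr0n// ?ler_nat// (leq_trans _ nm).
Qed.

Lemma lnS_le n : (0 < n)%N -> L n.+1 - L n <= n%:R^-1.
Proof.
move=> n0; have := @ln_diff_le n%:R n.+1%:R; rewrite !ltr0n => /(_ n0 isT).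
by rewrite -natr1 addrAC subrr add0r mul1r.
Qed.

Lemma lnS_ge n : (0 < n)%N -> n.+1%:R^-1 <= L n.+1 - L n.
Proof.
move=> n0; have := @ln_diff_le n.+1%:R n%:R; rewrite !ltr0n => /(_ isT n0).
have -> : (n%:R - n.+1%:R : R) = -1 by rewrite -natr1; ring.
by rewrite mulN1r lerNr opprB.
Qed.

Lemma ln_nat_le n : (0 < n)%N -> L n <= n%:R - 1.
Proof.
move=> n0; have := @ln_diff_le 1 n%:R; rewrite ltr01 ltr0n => /(_ isT n0).
by rewrite ln1 subr0 divr1.
Qed.

Lemma big_nat1S (F : nat -> R) N :
  \sum_(1 <= n < N.+2) F n = \sum_(1 <= n < N.+1) F n + F N.+1.
Proof. by rewrite big_nat_recr. Qed.

Lemma log_sum_lower N : (0 < N)%N -> N%:R * L N - N%:R <= T N.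
Proof.
rewrite /log_sum; elim: N => // -[|N] IH _; first by rewrite big_nat1 ln1; lra.
rewrite big_nat1S; move: (IH isT).
have := lnS_le (ltn0Sn N); move: (\sum_(_ <= _ < _) _) (L N.+2) (L N.+1) => s a b.
rewrite -[N.+2%:R]natr1; have : (0 : R) < N.+1%:R by rewrite ltr0n.
move: (N.+1%:R : R) => x x0 /(ler_wpM2l (ltW x0)); rewrite mulfV ?gt_eqF// => h1 h2.
lra.
Qed.

Lemma log_sum_upper N : (0 < N)%N -> T N <= (N%:R + 1) * L N - N%:R + 1.
Proof.
rewrite /log_sum; elim: N => // -[|N] IH _; first by rewrite big_nat1 ln1; lra.
rewrite big_nat1S; move: (IH isT).
have := lnS_ge (ltn0Sn N); move: (\sum_(_ <= _ < _) _) (L N.+2) (L N.+1) => s a b.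
rewrite -[N.+2%:R]natr1; have : (0 : R) < N.+1%:R by rewrite ltr0n.
move: (N.+1%:R : R) => x x0; have x1 : 0 < x + 1 by lra.
move=> /(ler_wpM2l (ltW x1)); rewrite mulfV ?gt_eqF// => h1 h2.
lra.
Qed.

Lemma log_sum_le N : (0 < N)%N -> T N <= N%:R * L N.
Proof. by move=> N0; have := log_sum_upper N0; have := ln_nat_le N0; lra. Qed.

Lemma divn_le_div N d : (N %/ d)%:R <= N%:R / d%:R :> R.
Proof.
case: d => [|d]; first by rewrite divn0 invr0 mulr0.
by rewrite ler_pdivlMr ?ltr0n// -natrM ler_nat leq_divM.
Qed.

Lemma div_lt_divnS N d : (0 < d)%N -> N%:R / d%:R < (N %/ d)%:R + 1 :> R.
Proof.
by move=> d0; rewrite ltr_pdivrMr ?ltr0n// natr1 -natrM ltr_nat ltn_ceil.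
Qed.

Lemma sum_le_divn (F : nat -> R) N d : (0 < d)%N ->
  \sum_(1 <= k < (N %/ d).+1) F k = \sum_(1 <= k < N.+1 | (d * k <= N)%N) F k.
Proof.
move=> d0; rewrite (@big_nat_widen _ _ _ 1 _ N.+1)/=; last by rewrite ltnS leq_div.
by apply: eq_bigl => k; rewrite ltnS leq_divRL// mulnC.
Qed.

(** Both sides sum [f d * g k] over the pairs with [d * k <= N], up to the names of the
    variables. *)
Lemma sum_hyperbola (f g : nat -> R) N :
  \sum_(1 <= d < N.+1) f d * (\sum_(1 <= k < (N %/ d).+1) g k) =
  \sum_(1 <= d < N.+1) g d * (\sum_(1 <= k < (N %/ d).+1) f k).
Proof.
transitivity (\sum_(1 <= d < N.+1) \sum_(1 <= k < N.+1 | (d * k <= N)%N) f d * g k).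
  by apply: eq_big_nat => d /andP[d0 _]; rewrite sum_le_divn// mulr_sumr.
rewrite (exchange_big_dep_nat xpredT)//=.
apply: eq_big_nat => d /andP[d0 _]; rewrite sum_le_divn// mulr_sumr.
by apply: eq_big => k; rewrite 1?mulnC// mulrC.
Qed.

Lemma sum_nat1_const (c : R) N : \sum_(1 <= k < N.+1) c = c * N%:R.
Proof. by rewrite sumr_const_nat subSS subn0 mulr_natr. Qed.

(** * Chebyshev's upper bound and Mertens' estimate *)

Lemma psi0 : psi 0 = 0. Proof. by rewrite /chebyshev_psi big_geq. Qed.

Lemma psiS N : psi N.+1 = psi N + Lam N.+1.
Proof. by rewrite /chebyshev_psi big_nat1S. Qed.

Lemma psi_homo N M : (N <= M)%N -> psi N <= psi M.
Proof.
move=> /subnK <-; elim: (M - N)%N => // k IH.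
by rewrite addSn psiS (le_trans IH)// lerDl vonMangoldt_ge0.
Qed.

Lemma psi_ge0 N : 0 <= psi N.
Proof. by rewrite -psi0 psi_homo. Qed.

Lemma sum_vonMangoldt_divn N :
  \sum_(1 <= d < N.+1) Lam d * (N %/ d)%:R = T N.
Proof.
transitivity (\sum_(1 <= d < N.+1) \sum_(1 <= k < (N %/ d).+1) Lam d).
  by apply: eq_bigr => d _; rewrite sum_nat1_const.
rewrite (@sum_div_exchange _ (fun d _ => Lam d)); apply: eq_big_nat => m mN.
by rewrite sum_divisors// sum_vonMangoldt_divisors//; case/andP: mN.
Qed.

Lemma sum_psi_divn N : \sum_(1 <= n < N.+1) psi (N %/ n) = T N.
Proof.
rewrite -sum_vonMangoldt_divn.
transitivity (\sum_(1 <= n < N.+1) 1 * psi (N %/ n)).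
  by apply: eq_bigr => n _; rewrite mul1r.
rewrite (@sum_hyperbola (fun=> 1) Lam).
by apply: eq_bigr => n _; rewrite sum_nat1_const mul1r.
Qed.

(** Chebyshev's argument: [Lam d] has coefficient [N %/ d - 2 * (M %/ d)] in [T N - 2 * T M], where
    [M = N %/ 2]. This is nonnegative, and equals 1 for [M < d <= N]. Stirling-type bounds for [T]
    finish the proof. *)
Lemma psi_half_le N : psi N - psi (N %/ 2)%N <= 4 * N%:R.
Proof.
have [N2|N2] := ltnP N 2.
  case: N N2 => [|[|//]] _; rewrite ?div0n; first lra.
  by rewrite psiS psi0 /vonMangoldt/= add0r subr0; lra.
set M := (N %/ 2)%N; have M0 : (0 < M)%N by rewrite divn_gt0.
have N0 : (0 < N)%N by lia.
have MN : (M <= N)%N by rewrite leq_div.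
have h : psi N - psi M <= T N - 2 * T M.
  have -> : T M = \sum_(1 <= d < N.+1) Lam d * (M %/ d)%:R.
    rewrite -sum_vonMangoldt_divn [RHS](@big_cat_nat _ _ _ M.+1)//=.
    rewrite [X in _ = _ + X]big1_seq ?addr0// => d.
    rewrite mem_index_iota => /andP[_ /andP[Md _]].
    by rewrite divn_small// mulr0.
  have -> : psi M = \sum_(1 <= d < N.+1) Lam d * (d <= M)%:R.
    rewrite [RHS](@big_cat_nat _ _ _ M.+1)//=.
    rewrite [X in _ = _ + X]big1_seq ?addr0; last first.
      move=> d; rewrite mem_index_iota => /andP[_ /andP[Md _]].
      by rewrite leqNgt Md mulr0.
    by apply: eq_big_nat => d /andP[_]; rewrite ltnS => ->; rewrite mulr1.
  rewrite -sum_vonMangoldt_divn mulr_sumr -!sumrB; apply: ler_sum_nat => d /andP[d0 dN].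
  have : ((d <= N) + 2 * (M %/ d) <= N %/ d + (d <= M))%N.
    rewrite /M divnAC; move: dN; rewrite ltnS => dN; rewrite dN.
    have q0 : (0 < N %/ d)%N by rewrite divn_gt0.
    have := leq_divM (N %/ d) 2; rewrite mulnC.
    case: (leqP d M) => dM //=; first lia.
    suff -> : (N %/ d %/ 2 = 0)%N by lia.
    by rewrite divnAC divn_small.
  move: dN; rewrite ltnS => -> /=.
  rewrite -(ler_nat R) [(1 + _)%:R]natrD [(N %/ d + _)%:R]natrD natrM => h.
  have := ler_wpM2l (vonMangoldt_ge0 R d) h.
  lra.
apply: le_trans h _.
have := log_sum_upper N0; have := log_sum_lower M0; have := ln_nat_le N0.
have := @ln_diff_le M%:R N%:R; rewrite !ltr0n => /(_ M0 N0).
have hN : (N%:R : R) <= 2 * M%:R + 1.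
  rewrite -natrM natr1 ler_nat /M; have := ltn_ceil N (isT : (0 < 2)%N); lia.
have hM : (2 * M%:R : R) <= N%:R.
  by rewrite -natrM ler_nat mulnC leq_divM.
have N1 : (2 : R) <= N%:R by rewrite (ler_nat _ 2).
have M1 : (1 : R) <= M%:R by rewrite ler1n.
have lM := ln_nat_ge0 M.
move: hN hM N1 M1 lM; move: (T N) (T M) (L N) (L M) => t s a b; move: (N%:R : R) (M%:R : R) => x y.
move=> xy yx x2 y1 b0 ab a1 h1 h2.
have ab2 : a - b <= 2.
  by apply: le_trans ab _; rewrite ler_pdivrMr; lra.
have : (x - 1) * (a - b) <= (x - 1) * 2 by apply: ler_wpM2l => //; lra.
have : (x - 1) * b <= 2 * y * b by apply: ler_wpM2r => //; lra.
lra.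
Qed.

Lemma chebyshev_upper N : psi N <= 8 * N%:R.
Proof.
elim/ltn_ind: N => -[|N] IH; first by rewrite psi0; lra.
have := psi_half_le N.+1; have := IH (N.+1 %/ 2)%N.
rewrite ltn_Pdiv// => /(_ isT); have := divn_le_div N.+1 2.
lra.
Qed.

(** Removing the truncation in [T N = \sum Lam d * (N %/ d)] only increases the sum; in
    [mertens_upper] it costs at most [psi N]. *)
Lemma mertens_lower N : (0 < N)%N ->
  L N - 1 <= \sum_(1 <= n < N.+1) Lam n / n%:R.
Proof.
move=> N0; have x0 : (0 : R) < N%:R by rewrite ltr0n.
rewrite -(ler_pM2l x0) mulrBr mulr1 (le_trans (log_sum_lower N0))//.
rewrite -sum_vonMangoldt_divn mulr_sumr; apply: ler_sum => n _.
by rewrite mulrCA ler_wpM2l ?vonMangoldt_ge0// divn_le_div.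
Qed.

Lemma mertens_upper N : (0 < N)%N ->
  \sum_(1 <= n < N.+1) Lam n / n%:R <= L N + 8.
Proof.
move=> N0; have x0 : (0 : R) < N%:R by rewrite ltr0n.
rewrite -(ler_pM2l x0); apply: (@le_trans _ _ (T N + psi N)); last first.
  by have := log_sum_upper N0; have := chebyshev_upper N; have := ln_nat_le N0; lra.
rewrite -sum_vonMangoldt_divn -big_split/= mulr_sumr; apply: ler_sum_nat => n /andP[n0 _].
rewrite mulrCA -[X in _ + X]mulr1 -mulrDr.
by rewrite ler_wpM2l ?vonMangoldt_ge0// ltW// div_lt_divnS.
Qed.

(** * Averages of logarithms of [N / d], and Euler's constant *)

Lemma sum_ln_ratio N : \sum_(1 <= d < N.+1) (L N - L d) = N%:R * L N - T N.
Proof. by rewrite sumrB sum_nat1_const mulrC. Qed.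

Lemma sum_ln_ratio_le N : \sum_(1 <= d < N.+1) (L N - L d) <= N%:R.
Proof.
case: N => [|N]; first by rewrite big_geq.
by rewrite sum_ln_ratio; have := log_sum_lower (ltn0Sn N); lra.
Qed.

(** Increasing [N] by one raises each logarithm by some [e <= 1 / N]. The cross terms then add at
    most 2 and the squares at most 1, whence the constant 3. *)
Lemma sum_ln_ratio_sqr_le N :
  \sum_(1 <= d < N.+1) (L N - L d) ^+ 2 <= 3 * N%:R.
Proof.
elim: N => [|[|N] IH]; first by rewrite big_geq//; lra.
  by rewrite big_nat1 subrr expr0n/=; lra.
rewrite big_nat1S subrr expr0n/= addr0.
have -> : \sum_(1 <= d < N.+2) (L N.+2 - L d) ^+ 2 =
   \sum_(1 <= d < N.+2) (L N.+1 - L d) ^+ 2 +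
   2 * (L N.+2 - L N.+1) * \sum_(1 <= d < N.+2) (L N.+1 - L d) +
   (L N.+2 - L N.+1) ^+ 2 * N.+1%:R.
  rewrite -sum_nat1_const mulr_sumr -!big_split/=; apply: eq_bigr => d _; ring.
have := sum_ln_ratio_le N.+1; have := lnS_le (ltn0Sn N).
have : 0 <= L N.+2 - L N.+1 by rewrite subr_ge0 ler_ln_nat.
move: IH; move: (\sum_(_ <= _ < _) _) (\sum_(_ <= _ < _) _) (L N.+2 - L N.+1) => s t e.
rewrite -[N.+2%:R]natr1; have : (1 : R) <= N.+1%:R by rewrite ler1n.
move: (N.+1%:R : R) => x x1 s3 e0 ex tx.
have x0 : 0 < x by lra.
have ex1 : e * x <= 1 by rewrite -ler_pdivlMr// mul1r.
have : e * s <= e * x by exact: ler_wpM2l.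
have : e * (e * x) <= e * 1 by exact: ler_wpM2l.
have : e <= 1 by apply: le_trans ex1; rewrite ler_peMr.
rewrite expr2; lra.
Qed.

Lemma sum_vonMangoldt_ln_ratio_le N :
  \sum_(1 <= d < N.+1) Lam d * (L N - L d) <= 8 * N%:R.
Proof.
elim: N => [|[|N] IH]; first by rewrite big_geq//; lra.
  by rewrite big_nat1 subrr mulr0; lra.
rewrite big_nat1S subrr mulr0 addr0.
have -> : \sum_(1 <= d < N.+2) Lam d * (L N.+2 - L d) =
   \sum_(1 <= d < N.+2) Lam d * (L N.+1 - L d) + psi N.+1 * (L N.+2 - L N.+1).
  rewrite /chebyshev_psi mulr_suml -!big_split/=; apply: eq_bigr => d _; ring.
have := lnS_le (ltn0Sn N); have := chebyshev_upper N.+1.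
have : 0 <= L N.+2 - L N.+1 by rewrite subr_ge0 ler_ln_nat.
move: IH; move: (psi _) (\sum_(_ <= _ < _) _) (L N.+2 - L N.+1) => p s e.
rewrite -[N.+2%:R]natr1; have : (0 : R) < N.+1%:R by rewrite ltr0n.
move: (N.+1%:R : R) => x x0 sx e0 px ex.
have ex1 : e * x <= 1 by rewrite -ler_pdivlMr// mul1r.
have : p * e <= 8 * x * e by exact: ler_wpM2r.
lra.
Qed.

Lemma harmonic_sumS N : H N.+1 = H N + N.+1%:R^-1.
Proof. by rewrite /harmonic_sum big_nat1S. Qed.

(** [g] is Euler's constant, obtained as the supremum of the increasing sequence [H N - L N.+1],
    which stays below the decreasing sequence [H N - L N]. *)
Lemma harmonic_gamma : exists g : R, 0 <= g <= 1 /\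
  forall N, (0 < N)%N -> L N + g <= H N <= L N.+1 + g.
Proof.
have H1 : H 1 = 1 by rewrite /harmonic_sum big_nat1 invr1.
have amono N M : (N <= M)%N -> H N - L N.+1 <= H M - L M.+1.
  move=> /subnK <-; elim: (M - N)%N => // k; rewrite addSn harmonic_sumS.
  have := lnS_le (ltn0Sn (k + N)).
  by move: (L (k + N).+1) (L (k + N).+2) ((k + N).+1%:R^-1) => a b c; lra.
have bmono N M : (0 < N)%N -> (N <= M)%N -> H M - L M <= H N - L N.
  move=> N0 /subnK <-; elim: (M - N)%N => // k; rewrite addSn harmonic_sumS.
  have kN : (0 < k + N)%N by lia.
  have := lnS_ge kN.
  by move: (L (k + N)) (L (k + N).+1) ((k + N).+1%:R^-1) => a b c; lra.
have ab N M : (0 < M)%N -> H N - L N.+1 <= H M - L M.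
  move=> M0; have := amono N (maxn N M) (leq_maxl _ _).
  have := bmono M (maxn N M) M0 (leq_maxr _ _).
  have := @ler_ln_nat (maxn N M) (maxn N M).+1 (leqnSn _); lra.
pose A := [set x : R | exists N, x = H N - L N.+1]%classic.
have Aub M : (0 < M)%N -> ubound A (H M - L M).
  by move=> M0 _ [N ->]; exact: ab.
have supA : has_sup A.
  by split; [exists (H 0 - L 1); exists 0%N|exists (H 1 - L 1); exact: Aub].
have lo N : H N - L N.+1 <= sup A by apply: ub_le_sup; [exact: supA.2|exists N].
have hi N : (0 < N)%N -> sup A <= H N - L N.
  by move=> N0; apply: ge_sup; [exact: supA.1|exact: Aub].
exists (sup A); split.
  have := lo 0%N; have := hi 1%N isT; rewrite H1 ln1 /harmonic_sum big_geq//; lra.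
by move=> N N0; have := lo N; have := hi N N0; lra.
Qed.

End Cheb.

(** * Selberg's formula *)

Definition psi_error {R : realType} (N : nat) : R := chebyshev_psi N - N%:R.

Definition vonMangoldt_conv {R : realType} (n : nat) : R :=
  \sum_(d <- divisors n) vonMangoldt d * vonMangoldt (n %/ d).

(** This is the Dirichlet convolution of [mu] with the squared logarithm; its mean behaviour is that
    of [2 * ln n]. *)
Definition selberg_coef {R : realType} (n : nat) : R :=
  vonMangoldt n * ln n%:R + vonMangoldt_conv n.

Section Selberg.
Variable R : realType.
Local Notation Lam := (@vonMangoldt R).
Local Notation mu := (@moebius R).
Local Notation psi := (@chebyshev_psi R).
Local Notation T := (@log_sum R).
Local Notation H := (@harmonic_sum R).
Local Notation err := (@psi_error R).
Local Notation conv := (@vonMangoldt_conv R).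
Local Notation coef := (@selberg_coef R).
Local Notation L n := (@ln R n%:R).
Implicit Types (n m d e p N M : nat).

(* Here g n stands for F (N / n), so that the left-hand side is the sum of
   mu(d) G(N / d) with G(x) = log x * sum_(n <= x) F(x / n). *)
Lemma tatuzawa_iseki (g : nat -> R) N : (0 < N)%N ->
  \sum_(1 <= d < N.+1) mu d * (L N - L d) * (\sum_(1 <= n < (N %/ d).+1) g (d * n)%N)
  = g 1%N * L N + \sum_(1 <= m < N.+1) Lam m * g m.
Proof.
move=> N0; under eq_bigr do rewrite mulr_sumr.
rewrite (sum_div_exchange (fun d k => mu d * (L N - L d) * g (d * k)%N)).
(* Grouping by [m = d * n], the coefficient of [g m] is the sum of [mu d * (L N - L d)] over the
   divisors of [m], known from the two Moebius identities. *)
transitivity (\sum_(1 <= m < N.+1) (L N * (m == 1%N)%:R * g m + Lam m * g m)).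
  apply: eq_big_nat => m mN; have m0 : (0 < m)%N by case/andP: mN.
  rewrite -mulrDl -sum_moebius_divisors// -[Lam m]opprK -sum_moebius_ln_divisors//.
  rewrite sum_divisors// mulr_sumr -sumrB mulr_suml.
  apply: eq_big_seq => d; rewrite -dvdn_divisors// => dm.
  by rewrite mulnC divnK//; ring.
rewrite big_split/=; congr (_ + _).
rewrite big_ltn// big1_seq => [|m]; first by rewrite eqxx addr0 mulr1 mulrC.
rewrite mem_index_iota => /andP[_ /andP[m1 _]].
by rewrite gtn_eqF// mulr0 mul0r.
Qed.

(** With [x = N / d] the sum is about [(x * ln x - x) - x * (ln x + g) + (g + 1) * x = 0]; this
    cancellation dictates the constant [g + 1]. Truncation leaves an error of logarithmic size. *)
Lemma psi_error_moebius_inner_bound (g : R) N d :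
  0 <= g <= 1 ->
  (forall N, (0 < N)%N -> L N + g <= H N <= L N.+1 + g) ->
  (0 < d <= N)%N ->
  `|\sum_(1 <= n < (N %/ d).+1)
      (psi (N %/ (d * n)) - N%:R / (d * n)%:R + (g + 1))| <= 3 + (L N - L d).
Proof.
move=> g01 hg /andP[d0 dN]; have M0 : (0 < N %/ d)%N by rewrite divn_gt0.
have d0' : (0 : R) < d%:R by rewrite ltr0n.
have -> : \sum_(1 <= n < (N %/ d).+1)
      (psi (N %/ (d * n)) - N%:R / (d * n)%:R + (g + 1)) =
  T (N %/ d) - N%:R / d%:R * H (N %/ d) + (g + 1) * (N %/ d)%:R.
  rewrite -sum_nat1_const -sum_psi_divn mulr_sumr -sumrB -big_split/=.
  apply: eq_bigr => n _; rewrite divnMA natrM invfM; ring.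
have lM : L (N %/ d) <= L N - L d.
  rewrite lerBrDr -lnM ?posrE ?ltr0n// -natrM ler_ln_nat//.
  exact: leq_divM.
have := divn_le_div R N d; have := div_lt_divnS R N d0.
have := log_sum_upper R M0; have := log_sum_lower R M0; have := hg _ M0.
have := lnS_le R M0; have := ln_nat_ge0 R (N %/ d).
have : (1 : R) <= (N %/ d)%:R by rewrite ler1n.
move: lM; move: (N%:R / d%:R) => y; move: (N %/ d)%N => M.
move: (H M) (T M) (L M.+1) (L M) (L N - L d) => h t b a c.
move: (M%:R : R) => x ac x1 a0 ba /andP[h1 h2] t1 t2 yx xy.
have x0 : 0 < x by lra.
have bax : (b - a) * x <= 1 by rewrite -ler_pdivlMr// mul1r.
have ba1 : b <= a + 1.
  suff : x^-1 <= 1 by lra.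
  by rewrite invf_le1.
have h0 : 0 <= h by lra.
have p1 : x * h <= y * h by exact: ler_wpM2r.
have p2 : y * h <= (x + 1) * h by apply: ler_wpM2r => //; lra.
have p3 : (x + 1) * h <= (x + 1) * (b + g) by apply: ler_wpM2l => //; lra.
have p4 : x * (a + g) <= x * h by apply: ler_wpM2l => //; lra.
by rewrite ler_norml; apply/andP; split; lra.
Qed.

(** The inversion costs [3 * N + 3 * N], by the first and second moments of the logarithms of
    [N / d]. Replacing [G m] by [err (N %/ m)] costs at most [2 * psi N + 2 * L N <= 18 * N], for a
    total of [24 * N]. *)
Lemma selberg_formula N : (0 < N)%N ->
  `|err N * L N + \sum_(1 <= m < N.+1) Lam m * err (N %/ m)| <= 24 * N%:R.
Proof.
move=> N0; have [g [g01 hg]] := harmonic_gamma R.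
pose G m : R := psi (N %/ m) - N%:R / m%:R + (g + 1).
have tiE := tatuzawa_iseki G N0.
have ti : `|G 1%N * L N + \sum_(1 <= m < N.+1) Lam m * G m| <= 6 * N%:R.
  rewrite -tiE; apply: le_trans (ler_norm_sum _ _ _) _.
  apply: (@le_trans _ _ (\sum_(1 <= d < N.+1) (3 * (L N - L d) + (L N - L d) ^+ 2))).
    apply: ler_sum_nat => d /andP[d0 dN].
    have l0 : 0 <= L N - L d by rewrite subr_ge0 ler_ln_nat.
    rewrite !normrM (ger0_norm l0).
    apply: (@le_trans _ _ (1 * (L N - L d) * (3 + (L N - L d)))); last lra.
    apply: ler_pM => //; first by rewrite mulr_ge0.
    - by rewrite ler_wpM2r// moebius_norm_le1.
    - by apply: psi_error_moebius_inner_bound => //; rewrite d0.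
  rewrite big_split/= -mulr_sumr.
  by have := sum_ln_ratio_le R N; have := sum_ln_ratio_sqr_le R N; lra.
have E : G 1%N * L N + \sum_(1 <= m < N.+1) Lam m * G m =
  (err N * L N + \sum_(1 <= m < N.+1) Lam m * err (N %/ m)) + (g + 1) * L N +
  \sum_(1 <= m < N.+1) Lam m * ((N %/ m)%:R - N%:R / m%:R + (g + 1)).
  have -> : \sum_(1 <= m < N.+1) Lam m * G m =
    \sum_(1 <= m < N.+1) Lam m * err (N %/ m) +
    \sum_(1 <= m < N.+1) Lam m * ((N %/ m)%:R - N%:R / m%:R + (g + 1)).
    by rewrite -big_split/=; apply: eq_bigr => m _; rewrite /G /psi_error; ring.
  by rewrite /G /psi_error divn1 divr1; ring.
have b1 : 0 <= \sum_(1 <= m < N.+1) Lam m * ((N %/ m)%:R - N%:R / m%:R + (g + 1)) <= 2 * psi N.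
  rewrite /chebyshev_psi mulr_sumr; apply/andP; split.
    rewrite big_nat_cond; apply: sumr_ge0 => m /andP[/andP[m0 _] _].
    rewrite mulr_ge0 ?vonMangoldt_ge0//.
    by have := div_lt_divnS R N m0; lra.
  apply: ler_sum => m _; rewrite mulrC; apply: ler_wpM2r; first exact: vonMangoldt_ge0.
  by have := divn_le_div R N m; lra.
have b2 : 0 <= (g + 1) * L N <= 2 * L N.
  have l0 := ln_nat_ge0 R N.
  by rewrite mulr_ge0 ?ler_wpM2r//; lra.
move: ti; rewrite E; move: b1 b2; have := chebyshev_upper R N; have := ln_nat_le R N0.
rewrite !ler_norml; lra.
Qed.

Lemma vonMangoldt_conv_ge0 n : 0 <= conv n.
Proof. by apply: sumr_ge0 => d _; rewrite mulr_ge0 ?vonMangoldt_ge0. Qed.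

Lemma sum_vonMangoldt_conv (F : nat -> R) N :
  \sum_(1 <= k < N.+1) conv k * F k =
  \sum_(1 <= m < N.+1) Lam m * (\sum_(1 <= n < (N %/ m).+1) Lam n * F (m * n)%N).
Proof.
under [RHS]eq_bigr do rewrite mulr_sumr.
rewrite (sum_div_exchange (fun m n => Lam m * (Lam n * F (m * n)%N))).
apply: eq_big_nat => k kN; rewrite sum_divisors// mulr_suml.
apply: eq_big_seq => d; rewrite -dvdn_divisors; last by case/andP: kN.
by move=> dk; rewrite -mulrA [in RHS]mulnC divnK.
Qed.

Lemma sum_vonMangoldt_ln N :
  psi N * L N - 8 * N%:R <= \sum_(1 <= k < N.+1) Lam k * L k <= psi N * L N.
Proof.
have -> : \sum_(1 <= k < N.+1) Lam k * L k =
    psi N * L N - \sum_(1 <= k < N.+1) Lam k * (L N - L k).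
  rewrite /chebyshev_psi mulr_suml -sumrB; apply: eq_bigr => k _; ring.
have : 0 <= \sum_(1 <= k < N.+1) Lam k * (L N - L k).
  rewrite big_nat_cond; apply: sumr_ge0 => k /andP[/andP[_ kN] _].
  by rewrite mulr_ge0 ?vonMangoldt_ge0// subr_ge0 ler_ln_nat.
by have := sum_vonMangoldt_ln_ratio_le R N; lra.
Qed.

(** The convolution sums to [\sum Lam m * err (N %/ m) + T N], and [Lam k * L k] to [psi N * L N]
    within [8 * N]. Selberg's formula and [T N = N * L N + O(N)] do the rest. *)
Lemma sum_selberg_coef_bound N : (0 < N)%N ->
  `|\sum_(1 <= k < N.+1) coef k - 2 * T N| <= 33 * N%:R.
Proof.
move=> N0; rewrite big_split/=.
have -> : \sum_(1 <= k < N.+1) conv k =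
    \sum_(1 <= m < N.+1) Lam m * err (N %/ m) + T N.
  transitivity (\sum_(1 <= k < N.+1) conv k * 1).
    by apply: eq_bigr => k _; rewrite mulr1.
  rewrite (sum_vonMangoldt_conv (fun=> 1)) -sum_vonMangoldt_divn -big_split/=.
  apply: eq_bigr => m _; rewrite /psi_error -mulrDr subrK; congr (_ * _).
  by apply: eq_bigr => n _; rewrite mulr1.
have := sum_vonMangoldt_ln N; have := selberg_formula N0.
have := log_sum_lower R N0; have := log_sum_le R N0.
rewrite [in X in _ -> _ -> X -> _]/psi_error mulrBl !ler_norml; lra.
Qed.

(** Dropping the nonnegative convolution and using [L k >= L n] bounds the growth of [psi] on short
    intervals. *)
Lemma selberg_coef_short_sum n m : (0 < n <= m)%N ->
  L n * (psi m - psi n) <= 2 * (T m - T n) + 66 * m%:R.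
Proof.
move=> /andP[n0 nm]; have m0 : (0 < m)%N by exact: leq_trans nm.
have h : L n * (psi m - psi n) <= \sum_(1 <= k < m.+1) coef k - \sum_(1 <= k < n.+1) coef k.
  rewrite /chebyshev_psi !(@big_cat_nat _ _ _ n.+1 1 m.+1)//=.
  rewrite !(addrC _ (\sum_(n.+1 <= _ < _) _)) !addrK mulr_sumr.
  apply: ler_sum_nat => k /andP[nk _].
  apply: (@le_trans _ _ (Lam k * L k)); last by rewrite lerDl vonMangoldt_conv_ge0.
  by rewrite mulrC ler_wpM2l ?vonMangoldt_ge0// ler_ln_nat// ltnW.
have := sum_selberg_coef_bound n0; have := sum_selberg_coef_bound m0.
have : (n%:R : R) <= m%:R by rewrite ler_nat.
rewrite !ler_norml; lra.
Qed.

Lemma psi_error_norm_le N : `|err N| <= 8 * N%:R.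
Proof.
rewrite /psi_error ler_norml; have := psi_ge0 R N; have := chebyshev_upper R N.
have : (0 : R) <= N%:R by rewrite ler0n.
lra.
Qed.

Lemma psi_error0 : err 0 = 0.
Proof. by rewrite /psi_error psi0 subrr. Qed.

Lemma summation_by_parts (b E : nat -> R) N :
  \sum_(1 <= k < N.+1) b k * E k =
  \sum_(1 <= k < N.+1) (\sum_(1 <= j < k.+1) b j) * (E k - E k.+1) +
  (\sum_(1 <= j < N.+1) b j) * E N.+1.
Proof.
elim: N => [|N IH]; first by rewrite !big_geq// mul0r addr0.
rewrite [LHS](@big_nat1S R) IH [X in _ = X + _](@big_nat1S R) !(@big_nat1S R b); ring.
Qed.

Lemma harmonic_sum_le N : (0 < N)%N -> H N <= 1 + L N.
Proof.
elim: N => // -[|N] IH _; first by rewrite /harmonic_sum big_nat1 invr1 ln1; lra.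
rewrite harmonic_sumS; have := IH isT; have := lnS_ge R (ltn0Sn N).
move: (H _) (L N.+1) (L N.+2) (N.+2%:R^-1) => a b c d; lra.
Qed.

(* Selberg's formula at N times log N, minus its Lambda-weighted sum over the
   quotients N %/ m: the terms Lambda(m) R(N/m) log (N/m) combine. *)
Lemma psi_error_selberg_coef_bound N : (0 < N)%N ->
  `|err N| * L N ^+ 2 <= \sum_(1 <= k < N.+1) coef k * `|err (N %/ k)| +
     48 * N%:R * L N + 64 * N%:R.
Proof.
move=> N0.
pose X M : R := err M * L M + \sum_(1 <= n < M.+1) Lam n * err (M %/ n).
have XE : err N * L N ^+ 2 = L N * X N - \sum_(1 <= m < N.+1) Lam m * X (N %/ m)%N
   - \sum_(1 <= m < N.+1) Lam m * err (N %/ m) * (L N - L (N %/ m))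
   + \sum_(1 <= k < N.+1) conv k * err (N %/ k).
  rewrite sum_vonMangoldt_conv /X mulrDr mulr_sumr -!addrA.
  rewrite -!sumrN -!big_split/= big1 ?addr0; first by ring.
  move=> m _; under [X in _ + (_ + (_ + _ * X))]eq_bigr do rewrite divnMA.
  ring.
have XN : `|L N * X N| <= 24 * N%:R * L N.
  rewrite normrM (ger0_norm (ln_nat_ge0 R N)) mulrC ler_wpM2r ?ln_nat_ge0//.
  exact: selberg_formula.
have XS : `|\sum_(1 <= m < N.+1) Lam m * X (N %/ m)%N| <= 24 * N%:R * L N.
  apply: (@le_trans _ _ (24 * T N)); last by have := log_sum_le R N0; lra.
  apply: le_trans (ler_norm_sum _ _ _) _.
  rewrite -sum_vonMangoldt_divn mulr_sumr; apply: ler_sum_nat => m /andP[m0 mN].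
  rewrite normrM (ger0_norm (vonMangoldt_ge0 R m)) mulrCA ler_wpM2l ?vonMangoldt_ge0//.
  by apply: selberg_formula; rewrite divn_gt0.
have XD : `|\sum_(1 <= m < N.+1) Lam m * err (N %/ m) * (L N - L (N %/ m))| <=
    \sum_(1 <= m < N.+1) Lam m * L m * `|err (N %/ m)| + 64 * N%:R.
  apply: (@le_trans _ _ (\sum_(1 <= m < N.+1) (Lam m * L m * `|err (N %/ m)| + 8 * Lam m))); last first.
    rewrite big_split/= lerD2l -mulr_sumr; have := chebyshev_upper R N.
    by rewrite /chebyshev_psi; lra.
  apply: le_trans (ler_norm_sum _ _ _) _; apply: ler_sum_nat => m /andP[m0 mN].
  have M0 : (0 < N %/ m)%N by rewrite divn_gt0.
  have l1 : L (N %/ m) <= L N by rewrite ler_ln_nat// leq_div.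
  rewrite !normrM (ger0_norm (vonMangoldt_ge0 R m)) [`|L N - _|]ger0_norm ?subr_ge0//.
  rewrite [8 * _]mulrC -!mulrA -mulrDr ler_wpM2l ?vonMangoldt_ge0//.
  (* Truncating [N / m] changes its logarithm by at most the reciprocal of the quotient, which the
     bound [8 * (N %/ m)] for the error absorbs. *)
  have ld : L N - L m - L (N %/ m) <= (N %/ m)%:R^-1.
    rewrite -ln_div ?posrE ?ltr0n//.
    apply: le_trans (ln_diff_le _ _) _; rewrite ?divr_gt0 ?ltr0n//.
    rewrite ler_pdivrMr ?ltr0n// mulVf ?pnatr_eq0 -?lt0n//.
    by have := div_lt_divnS R N m0; lra.
  have e8 : `|err (N %/ m)| * (L N - L m - L (N %/ m)) <= 8.
    apply: le_trans (ler_wpM2l (normr_ge0 _) ld) _.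
    by rewrite ler_pdivrMr ?ltr0n// psi_error_norm_le.
  lra.
have XC : `|\sum_(1 <= k < N.+1) conv k * err (N %/ k)| <=
   \sum_(1 <= k < N.+1) conv k * `|err (N %/ k)|.
  apply: le_trans (ler_norm_sum _ _ _) _; apply: ler_sum => k _.
  by rewrite normrM (ger0_norm (vonMangoldt_conv_ge0 k)).
rewrite -[L N ^+ 2]ger0_norm ?sqr_ge0// -normrM XE.
under [X in _ <= X + _ + _]eq_bigr do rewrite mulrDl.
rewrite big_split/=; move: XN XS XD XC; rewrite !ler_norml; lra.
Qed.

(* Summation by parts replaces the Selberg coefficients by 2 log k, their average. *)
Lemma psi_error_log_average_bound N : (0 < N)%N ->
  `|err N| * L N ^+ 2 <= 2 * (\sum_(1 <= k < N.+1) L k * `|err (N %/ k)|) +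
     120 * N%:R * (1 + L N).
Proof.
move=> N0; have := psi_error_selberg_coef_bound N0.
pose E k : R := `|err (N %/ k)|.
pose P k : R := psi (N %/ k) + (N %/ k)%:R.
have divN : (N %/ N.+1 = 0)%N by rewrite divn_small.
(* [P] is monotone in [k] and its differences dominate those of [E], so the total variation of [E]
   can be controlled without absolute values. *)
have EP k : (0 < k)%N -> `|E k - E k.+1| <= P k - P k.+1.
  move=> k0; apply: le_trans (ler_dist_dist _ _) _.
  have le : (N %/ k.+1 <= N %/ k)%N by rewrite leq_div2l.
  have := psi_homo R le; have : ((N %/ k.+1)%:R : R) <= (N %/ k)%:R by rewrite ler_nat.
  by rewrite /P /psi_error ler_norml; lra.
(* Summation by parts with constant weight 1, read backwards, turns this into the plain sum of
   [P k]. *)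
have S1 : \sum_(1 <= k < N.+1) k%:R * (P k - P k.+1) <= 2 * N%:R * L N + N%:R.
  have := summation_by_parts (fun=> 1) P N.
  rewrite [P N.+1]/P divN psi0 addr0 mulr0 addr0.
  under [in X in _ = X]eq_bigr do rewrite sum_nat1_const mul1r.
  move=> <-; under eq_bigr do rewrite mul1r.
  rewrite big_split/= sum_psi_divn; have := log_sum_le R N0.
  have : \sum_(1 <= i < N.+1) (N %/ i)%:R <= N%:R * H N.
    by rewrite mulr_sumr; apply: ler_sum => k _; exact: divn_le_div.
  have : N%:R * H N <= N%:R * (1 + L N) by rewrite ler_wpM2l// harmonic_sum_le.
  lra.
have S2 : \sum_(1 <= k < N.+1) (coef k - 2 * L k) * E k <= 33 * (2 * N%:R * L N + N%:R).
  rewrite summation_by_parts [E N.+1]/E divN psi_error0 normr0 mulr0 addr0.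
  apply: le_trans (ler_wpM2l _ S1); last by [].
  rewrite mulr_sumr; apply: ler_sum_nat => k /andP[k0 _].
  apply: le_trans (ler_norm _) _; rewrite normrM mulrA ler_pM ?EP//.
  rewrite sumrB -mulr_sumr; exact: sum_selberg_coef_bound.
have -> : \sum_(1 <= k < N.+1) coef k * `|err (N %/ k)| =
    \sum_(1 <= k < N.+1) (coef k - 2 * L k) * E k + 2 * (\sum_(1 <= k < N.+1) L k * `|err (N %/ k)|).
  by rewrite mulr_sumr -big_split/=; apply: eq_bigr => k _; rewrite /E; ring.
have : (0 : R) <= N%:R by rewrite ler0n.
have : 0 <= N%:R * L N by rewrite mulr_ge0 ?ln_nat_ge0.
lra.
Qed.

End Selberg.

(** * Intervals where the error of psi is small *)

Section Good.
Variable R : realType.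
Local Notation Lam := (@vonMangoldt R).
Local Notation psi := (@chebyshev_psi R).
Local Notation T := (@log_sum R).
Local Notation H := (@harmonic_sum R).
Local Notation err := (@psi_error R).
Local Notation L n := (@ln R n%:R).
Implicit Types (n m d e p N M y k K : nat).

Lemma nat_above (x : R) : exists2 K, (0 < K)%N & x <= K%:R.
Proof. by exists (Num.truncn x).+1 => //; rewrite ltW// truncnS_gt. Qed.

Lemma ln_nat_unbounded (x : R) :
  exists2 K, (0 < K)%N & forall n, (K <= n)%N -> x <= L n.
Proof.
have [K K0 xK] := nat_above (expR x); exists K => // n Kn.
by apply: le_trans (ler_ln_nat R Kn); rewrite -ler_expR lnK// posrE ltr0n.
Qed.

Lemma ln_nat_le_eps (eps : R) : 0 < eps ->
  exists2 K, (0 < K)%N & forall n, (K <= n)%N -> L n <= eps * n%:R.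
Proof.
(* The tangent of the logarithm at [2 / eps] has slope [eps / 2]; the other half of [eps * n]
   absorbs its constant term. *)
move=> e0; pose x := 2 / eps; have x0 : 0 < x by rewrite divr_gt0.
have [K K0 xK] := nat_above (2 * ln x / eps); exists K => // n Kn.
have n0 : (0 < n)%N by exact: leq_trans Kn.
have := @ln_diff_le _ x n%:R x0; rewrite ltr0n => /(_ n0).
rewrite mulrBl divff ?gt_eqF//.
have -> : n%:R / x = eps * n%:R / 2 by rewrite /x; field; rewrite gt_eqF.
have : 2 * ln x <= eps * n%:R.
  by rewrite mulrC -[_ * n%:R]mulrC -ler_pdivrMr// mulrC (le_trans xK)// ler_nat.
lra.
Qed.

(** Summation by parts reduces this to the Mertens sum minus [H N], both [L N + O(1)], with a
    bounded boundary term. *)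
Lemma psi_error_series_le N : (0 < N)%N ->
  `|\sum_(1 <= n < N.+1) err n * (n%:R^-1 - n.+1%:R^-1)| <= 16.
Proof.
move=> N0; have [g [g01 hg]] := harmonic_gamma R.
have E1 := summation_by_parts Lam (fun k => k%:R^-1) N.
have E2 := summation_by_parts (fun=> 1) (fun k => k%:R^-1 : R) N.
have -> : \sum_(1 <= n < N.+1) err n * (n%:R^-1 - n.+1%:R^-1) =
  \sum_(1 <= n < N.+1) Lam n / n%:R - H N - err N / N.+1%:R.
  rewrite E1; have -> : H N = \sum_(1 <= k < N.+1) 1 * k%:R^-1.
    by apply: eq_bigr => k _; rewrite mul1r.
  rewrite E2 /psi_error /chebyshev_psi sum_nat1_const mul1r.
  under eq_bigr do rewrite mulrBl.
  rewrite sumrB; under [X in _ = _ - (X + _) - _]eq_bigr do rewrite sum_nat1_const mul1r.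
  ring.
have h1 := mertens_lower R N0; have h2 := mertens_upper R N0.
have /andP[h3 h4] := hg _ N0; have h5 := lnS_le R N0.
have h6 : `|err N / N.+1%:R| <= 8.
  rewrite normrM [`|_^-1|]ger0_norm ?invr_ge0// ler_pdivrMr ?ltr0n//.
  apply: le_trans (psi_error_norm_le _ _) _.
  by rewrite ler_wpM2l// ler_nat.
have h7 : N%:R^-1 <= 1 :> R by rewrite invf_le1 ?ltr0n// ler1n.
move: h1 h2 h3 h4 h5 h6 h7; rewrite !ler_norml.
move: (_ / N.+1%:R) (L N.+1) (L N) (N%:R^-1) (H N) (\sum_(_ <= _ < _) _) => a b c d e f.
move=> h1 h2 h3 h4 h5 h6 h7; lra.
Qed.

Lemma psi_errorS n : err n.+1 = err n + Lam n.+1 - 1.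
Proof. by rewrite /psi_error psiS -natr1; ring. Qed.

(* R changes by at most log n at each step, so without a small value it keeps its
   sign on [y, K * y], and sum R(n)/n(n+1) over that interval is too large. *)
Lemma psi_error_small_point (delta : R) : 0 < delta ->
  exists y0 K, [/\ (0 < y0)%N, (0 < K)%N & forall y, (y0 <= y)%N ->
    exists n, (y <= n <= K * y)%N /\ `|err n| <= delta * n%:R].
Proof.
(* A difference of two partial sums is at most [16 + 16 = 32], so 33 is a contradiction; the extra 1
   absorbs [L y.+1 - L y]. *)
move=> d0; have [K K0 hK] := ln_nat_unbounded (33 / delta + 1).
have d20 : 0 < delta / 2 by rewrite divr_gt0.
have [y1 y10 hy1] := ln_nat_le_eps d20.
have [y2 y20 hy2] := nat_above delta^-1.
exists (maxn y1 y2), K; split => //; first by rewrite leq_max y10.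
move=> y; rewrite geq_max => /andP[y1y y2y]; apply: contrapT => noex.
have y0 : (0 < y)%N by exact: leq_trans y1y.
have big n : (y <= n <= K * y)%N -> delta * n%:R < `|err n|.
  by move=> ny; rewrite ltNge; apply/negP => h; apply: noex; exists n.
have dn1 n : (y <= n)%N -> 1 <= delta * n%:R.
  move=> yn; rewrite mulrC -ler_pdivrMr// mul1r (le_trans hy2)// ler_nat.
  exact: leq_trans yn.
have dl n : (y <= n)%N -> Lam n.+1 <= delta * n%:R.
  move=> yn; apply: le_trans (vonMangoldt_le_ln _ _) _.
  apply: le_trans (hy1 n.+1 _) _; first by lia.
  have : (1 : R) <= n%:R by rewrite ler1n; lia.
  move/(ler_wpM2l (ltW d0)); rewrite -[n.+1%:R]natr1.
  by move: (n%:R : R) => x; lra.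
have yK : (y <= K * y)%N by rewrite leq_pmull.
have E : (\sum_(y <= n < K * y) err n * (n%:R^-1 - n.+1%:R^-1) : R) =
   \sum_(1 <= n < (K * y).-1.+1) err n * (n%:R^-1 - n.+1%:R^-1) -
   \sum_(1 <= n < y.-1.+1) err n * (n%:R^-1 - n.+1%:R^-1).
  rewrite !prednK ?muln_gt0 ?K0//.
  by rewrite (@big_cat_nat _ _ _ y 1 (K * y))//= addrC addrK.
have ub : `|\sum_(y <= n < K * y) err n * (n%:R^-1 - n.+1%:R^-1)| <= 32.
  have bd N : `|\sum_(1 <= n < N.+1) err n * (n%:R^-1 - n.+1%:R^-1)| <= 16.
    case: N => [|N]; first by rewrite big_geq// normr0.
    exact: psi_error_series_le.
  rewrite E; have := bd (K * y).-1; have := bd y.-1.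
  by rewrite !ler_norml; lra.
(* [s] is the sign of the error. Each term exceeds [delta / n.+1], hence [delta] times an increment
   of the logarithm, and these telescope to about [delta * L K]. *)
have lb (s : R) : (forall n, (y <= n < K * y)%N -> delta * n%:R < s * err n) ->
  33 <= s * \sum_(y <= n < K * y) err n * (n%:R^-1 - n.+1%:R^-1).
  move=> hs; apply: (@le_trans _ _ (\sum_(y <= n < K * y) delta * (L n.+2 - L n.+1))).
    rewrite -mulr_sumr (@telescope_sumr _ _ _ (fun n => L n.+1))//.
    have l1 : L (K * y)  <= L (K * y).+1 by rewrite ler_ln_nat.
    have l2 : L y.+1 <= L y + 1.
      have := lnS_le R y0; have : y%:R^-1 <= 1 :> R by rewrite invf_le1 ?ltr0n// ler1n.
      lra.
    rewrite natrM lnM ?posrE ?ltr0n// in l1.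
    have l3 := hK _ (leqnn K).
    have l4 : 33 / delta <= L (K * y).+1 - L y.+1 by lra.
    by rewrite mulrC -ler_pdivrMr.
  rewrite mulr_sumr; apply: ler_sum_nat => n yn; rewrite mulrA.
  have n0 : (0 < n)%N by lia.
  have := hs _ yn; have := lnS_le R (ltn0Sn n).
  have -> : n%:R^-1 - n.+1%:R^-1 = n%:R^-1 / n.+1%:R :> R.
    by rewrite -natr1; field; rewrite natr1 !pnatr_eq0 -!lt0n n0.
  move=> h1 h2; apply: (@le_trans _ _ (delta / n.+1%:R)); first exact: (ler_wpM2l (ltW d0) h1).
  rewrite mulrA ler_pM2r ?invr_gt0 ?ltr0n//.
  by rewrite ler_pdivlMr ?ltr0n// ltW.
(* A downward step is at most 1 and an upward step at most [Lam n.+1], both bounded by [delta * n],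
   so the error cannot jump across the gap around 0. *)
have [ey|ey] := leP 0 (err y).
  have pos j : (y + j <= K * y)%N -> delta * (y + j)%:R < err (y + j).
    elim: j => [|j IH] hj; first by have := big y; rewrite addn0 ger0_norm// leqnn yK; exact.
    have {}IH := IH ltac:(lia).
    have := big (y + j.+1)%N; rewrite hj leq_addr => /(_ isT).
    have p1 : 1 <= delta * (y + j)%:R by apply: dn1; lia.
    rewrite addnS; have : 0 < err (y + j).+1.
      by rewrite psi_errorS; have := vonMangoldt_ge0 R (y + j).+1; lra.
    by move=> e0; rewrite gtr0_norm.
  have := lb 1; rewrite mul1r => lb1.
  suff /lb1 : forall n, (y <= n < K * y)%N -> delta * n%:R < 1 * err n.
    by move: ub; rewrite ler_norml; lra.
  move=> n yn; rewrite mul1r; have := pos (n - y)%N.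
  by rewrite subnKC; [apply|]; lia.
have neg j : (y + j <= K * y)%N -> delta * (y + j)%:R < - err (y + j).
  elim: j => [|j IH] hj; first by have := big y; rewrite addn0 ltr0_norm// leqnn yK; exact.
  have {}IH := IH ltac:(lia).
  have := big (y + j.+1)%N; rewrite hj leq_addr => /(_ isT).
  have p1 : Lam (y + j).+1 <= delta * (y + j)%:R by apply: dl; lia.
  rewrite addnS; have : err (y + j).+1 < 0.
    by rewrite psi_errorS; lra.
  by move=> e0; rewrite ltr0_norm.
have lb1 := lb (-1).
suff /lb1 : forall n, (y <= n < K * y)%N -> delta * n%:R < -1 * err n.
  by move: ub; rewrite ler_norml mulN1r; lra.
move=> n yn; rewrite mulN1r; have := neg (n - y)%N.
by rewrite subnKC; [apply|]; lia.
Qed.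

Lemma psi_short_interval (delta : R) : 0 < delta ->
  exists2 N0, (0 < N0)%N & forall n m, (N0 <= n)%N -> (n <= m <= 2 * n)%N ->
    psi m - psi n <= 2 * (m%:R - n%:R) + delta * n%:R.
Proof.
(* [138 = 4 + 2 + 132] collects the terms free of [L n], using [m <= 2 * n]; the last is twice 66
   from [selberg_coef_short_sum]. *)
move=> d0; have [N0 N00 hN0] := ln_nat_unbounded (Num.max 1 (138 / delta)).
exists N0 => // n m Nn /andP[nm m2n].
have n0 : (0 < n)%N by exact: leq_trans Nn.
have m0 : (0 < m)%N by exact: leq_trans nm.
have := hN0 _ Nn; rewrite ge_max => /andP[l1]; rewrite ler_pdivrMr// => l2.
have h : (0 < n <= m)%N by rewrite n0.
have := selberg_coef_short_sum R h.
have t1 := log_sum_lower R n0; have t2 := log_sum_le R m0.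
have t3 : m%:R * (L m - L n) <= 2 * (m%:R - n%:R).
  have := @ln_diff_le _ (n%:R : R) m%:R; rewrite !ltr0n => /(_ n0 m0) h1.
  apply: le_trans (ler_wpM2l (ler0n _ _) h1) _.
  rewrite mulrA ler_pdivrMr ?ltr0n// -mulrA [X in _ <= 2 * X]mulrC mulrA.
  by rewrite ler_wpM2r ?subr_ge0 ?ler_nat// -natrM ler_nat.
have mn : (n%:R : R) <= m%:R by rewrite ler_nat.
have mn2 : (m%:R : R) <= 2 * n%:R by rewrite -natrM ler_nat.
have n00 : (0 : R) < n%:R by rewrite ltr0n.
move: t1 t2 t3; move: (psi m - psi n) (T m) (T n) (L n) (L m) l1 l2 => p a b c d l1 l2.
move: (n%:R : R) (m%:R : R) n00 mn mn2 => x z x0 xz zx t1 t2 t3 t4.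
have c0 : 0 < c by lra.
rewrite -(ler_pM2l c0); apply: le_trans t4 _.
have : 138 * x <= c * delta * x by rewrite ler_wpM2r// ltW.
lra.
Qed.

(** Start from a point with error at most [n / k]. Up to [n + n %/ k] the error falls by at most
    [n / k], as [psi] is monotone, and rises by at most [2 * n / k], by [psi_short_interval]. *)
Lemma psi_error_small_interval k : (0 < k)%N ->
  exists y0 K, [/\ (0 < y0)%N, (0 < K)%N & forall y, (y0 <= y)%N ->
    exists2 n, (y <= n <= K * y)%N & forall m, (n <= m <= n + n %/ k)%N ->
      `|err m| <= 3 / k%:R * m%:R].
Proof.
move=> k0; have kk : (0 : R) < k%:R by rewrite ltr0n.
have d0 : (0 : R) < k%:R^-1 by rewrite invr_gt0.
have [y0 [K [y00 K0 hy]]] := psi_error_small_point d0.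
have [N0 N00 hN] := psi_short_interval d0.
exists (maxn y0 N0), K; split => //; first by rewrite leq_max y00.
move=> y; rewrite geq_max => /andP[y0y N0y].
have [n [yn en]] := hy _ y0y; exists n => // m /andP[nm mn].
have N0n : (N0 <= n)%N by lia.
have m2n : (n <= m <= 2 * n)%N by have := leq_div n k; lia.
have := hN _ _ N0n m2n; have := psi_homo R nm.
have h1 : (m%:R - n%:R : R) <= k%:R^-1 * n%:R.
  rewrite mulrC; apply: le_trans (divn_le_div R n k).
  by rewrite lerBlDl -natrD ler_nat.
have h2 : k%:R^-1 * n%:R <= k%:R^-1 * m%:R :> R by rewrite ler_wpM2l ?ler_nat// ltW.
have h3 : (n%:R : R) <= m%:R by rewrite ler_nat.
move: en h1 h2 h3; rewrite /psi_error !ler_norml.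
have -> : 3 / k%:R * m%:R = 3 * (k%:R^-1 * m%:R) :> R by ring.
move: (k%:R^-1 * n%:R) (k%:R^-1 * m%:R) => a b; lra.
Qed.

End Good.

(** * The prime number theorem for psi *)

Definition small_psi_error {R : realType} (k M : nat) : bool :=
  `|psi_error M| <= 3 / k%:R * M%:R :> R.

Section PNT.
Variable R : realType.
Local Notation err := (@psi_error R).
Local Notation small := (@small_psi_error R).
Local Notation L n := (@ln R n%:R).
Implicit Types (n m d e p N M y k K : nat).

Lemma ler_sum_subrange (F : nat -> R) a b c d : (a <= b)%N -> (b <= c)%N ->
  (c <= d)%N -> (forall i, 0 <= F i) ->
  \sum_(b <= i < c) F i <= \sum_(a <= i < d) F i.
Proof.
move=> ab bc cd F0; rewrite (@big_cat_nat _ _ _ b a d)//=; last exact: leq_trans cd.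
rewrite (@big_cat_nat _ _ _ c b d)//= addrCA lerDl addr_ge0//.
  exact: sumr_ge0.
exact: sumr_ge0.
Qed.

(** Without truncation the product is [1 - n / (n + n %/ k).+1], at least [1 / (2 * k)]. Truncation
    costs [n / N <= 1 / (4 * k)]. *)
Lemma reciprocal_block_bound k n N : (0 < k)%N -> (0 < n)%N -> (4 * k * n <= N)%N ->
  1 / (4 * k%:R) <= ((N %/ n)%:R - (N %/ (n + n %/ k).+1)%:R) * (n%:R / N%:R) :> R.
Proof.
move=> k0 n0 knN; have N0 : (0 < N)%N by nia.
have hc := div_lt_divnS R N n0.
have hf := divn_le_div R N (n + n %/ k).+1.
have hk : (n%:R * (k%:R + 1) <= ((n + n %/ k).+1)%:R * k%:R :> R).
  by rewrite natr1 -!natrM ler_nat; have := ltn_ceil n k0; nia.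
move: knN; rewrite -(ler_nat R) !natrM.
move: hc hf hk; move: ((n + n %/ k).+1) (ltn0Sn (n + n %/ k)) => z.
rewrite -(ltr_nat R); move: ((N %/ n)%:R) ((N %/ z)%:R) => u v.
have : (1 : R) <= k%:R by rewrite ler1n.
have : (0 : R) < n%:R by rewrite ltr0n.
have : (0 : R) < N%:R by rewrite ltr0n.
move: (k%:R : R) (n%:R : R) (N%:R : R) (z%:R : R) => K x Y Z Y0 x0 K1 Z0 hu hv hk hY.
have K0 : 0 < K by lra.
apply: (@le_trans _ _ ((Y / x - 1 - Y / Z) * (x / Y))); last first.
  by rewrite ler_wpM2r ?divr_ge0 ?ltW//; lra.
have -> : (Y / x - 1 - Y / Z) * (x / Y) = 1 - x / Y - x / Z.
  by field; rewrite !gt_eqF.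
have h1 : x / Y <= 1 / (4 * K).
  by rewrite ler_pdivrMr// mulrC mulrA mulr1 ler_pdivlMr ?mulr_gt0//; lra.
have h2 : x / Z <= 1 - 1 / (2 * K).
  have -> : 1 - 1 / (2 * K) = (2 * K - 1) / (2 * K) by field; rewrite gt_eqF.
  rewrite ler_pdivrMr// mulrAC ler_pdivlMr ?mulr_gt0//.
  have p1 : (2 * K - 1) * (x * (K + 1)) <= (2 * K - 1) * (Z * K).
    by apply: ler_wpM2l => //; lra.
  have p2 : 0 <= x * (K - 1) by apply: mulr_ge0; lra.
  rewrite -(ler_pM2r K0); lra.
have -> : 1 / (4 * K) = 1 / (2 * K) - 1 / (4 * K) by field; rewrite gt_eqF.
lra.
Qed.

(* If the error is small on [n, n + n %/ k], the indices i with N %/ i in that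
   interval are those of the block (N %/ (n + n %/ k).+1, N %/ n]. *)
Lemma small_psi_error_block k : (1 < k)%N ->
  exists Q y1, [/\ (1 < Q)%N, (0 < y1)%N & forall y N, (y1 <= y)%N ->
    ((Q * y) ^ 2 <= N)%N ->
    L N / (8 * k%:R) <=
      \sum_((N %/ (Q * y)).+1 <= i < (N %/ y).+1) (small k (N %/ i))%:R * (L i / i%:R)].
Proof.
move=> k1; have k0 : (0 < k)%N by exact: ltnW.
have [y0 [K [y00 K0 hy]]] := psi_error_small_interval R k0.
(* The factor 2 makes room for the right end [n + n %/ k], and [y >= k] yields
   [4 * k * n <= (2 * K * y) ^ 2 <= N]. *)
exists (2 * K)%N, (maxn y0 k); split; first by lia.
  by rewrite leq_max y00.
move=> y N; rewrite geq_max => /andP[y0y ky] QN.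
have [n /andP[yn nK] hn] := hy _ y0y.
have y_gt0 : (0 < y)%N by exact: leq_trans y0y.
have n0 : (0 < n)%N by exact: leq_trans yn.
set m := (n + n %/ k)%N in hn.
have knN : (4 * k * n <= N)%N.
  apply: leq_trans QN; have : (k <= K * y)%N by nia.
  rewrite expnS expn1; nia.
have N0 : (0 < N)%N by nia.
have mQ : (m.+1 <= 2 * K * y)%N.
  have : (n %/ k < n)%N by rewrite ltn_Pdiv.
  by rewrite /m; nia.
have ge0 i : 0 <= (small k (N %/ i))%:R * (L i / i%:R) :> R.
  by rewrite mulr_ge0// divr_ge0// ln_nat_ge0.
apply: le_trans (@ler_sum_subrange _ _ (N %/ m.+1).+1 (N %/ n).+1 _ _ _ _ ge0); first last.
- by rewrite ltnS leq_div2l.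
- by rewrite ltnS leq_div2l// /m; lia.
- by rewrite ltnS leq_div2l.
(* On the block [i ^ 2 >= N], so [L i >= L N / 2], while [i <= N / n]. *)
apply: (@le_trans _ _ (\sum_((N %/ m.+1).+1 <= i < (N %/ n).+1) L N / 2 * (n%:R / N%:R))).
  rewrite sumr_const_nat subSS -[X in _ <= X]mulr_natr natrB; last first.
    by rewrite leq_div2l// /m; lia.
  have := reciprocal_block_bound k0 n0 knN; rewrite -/m.
  move: (_ - _) (n%:R / N%:R) => a b /(ler_wpM2l (ln_nat_ge0 R N)).
  have -> : L N / (8 * k%:R) = L N * (1 / (4 * k%:R)) / 2 by field; rewrite pnatr_eq0 -lt0n.
  lra.
apply: ler_sum_nat => i /andP[]; rewrite ltn_divLR// ltnS leq_divRL// => Ni iN.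
have i0 : (0 < i)%N by case: i Ni {iN} => //; rewrite mul0n.
have -> : small k (N %/ i).
  apply: hn; rewrite leq_divRL// mulnC iN/= -ltnS ltn_divLR//.
  by rewrite mulnC.
rewrite mul1r; apply: ler_pM.
- by rewrite divr_ge0// ln_nat_ge0.
- by rewrite divr_ge0.
- have Nii : (N <= i ^ 2)%N.
    have : (N < i * (2 * K * y))%N by nia.
    move: QN; move: (2 * K * y)%N => q; rewrite !expnS !expn0 !muln1 => h1 h2.
    rewrite leqNgt; apply/negP => h3; nia.
  rewrite ler_pdivrMr//; apply: le_trans (ler_ln_nat R Nii) _.
  by rewrite natrX lnXn ?ltr0n// mulr_natr.
- rewrite ler_pdivrMr ?ltr0n// mulrC ler_pdivlMr ?ltr0n//.
  by rewrite -natrM ler_nat mulnC.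
Qed.

(** The blocks for [y = Q ^ j * y1] are disjoint. About [L N / (4 * L Q)] of them fit under the
    square root of [N], each of weight at least [L N / (8 * k)]. *)
Lemma small_psi_error_mass k : (1 < k)%N ->
  exists2 c : R, 0 < c & exists2 N0, (0 < N0)%N & forall N, (N0 <= N)%N ->
    c * L N ^+ 2 <=
      \sum_(1 <= i < N.+1) (small k (N %/ i))%:R * (L i / i%:R).
Proof.
move=> k1; have [Q [y1 [Q1 y10 hb]]] := small_psi_error_block k1.
have LQ : 0 < L Q by rewrite ln_gt0// ltr1n.
have kk : (0 : R) < k%:R by rewrite ltr0n ltnW.
exists ((64 * k%:R * L Q)^-1); first by rewrite invr_gt0 !mulr_gt0.
have [N0 N00 hN0] := ln_nat_unbounded (Num.max (8 * L Q) (4 * L y1)).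
exists N0 => // N NN0; have N_gt0 : (0 < N)%N by exact: leq_trans NN0.
have := hN0 _ NN0; rewrite ge_max => /andP[l1 l2].
have ge0 i : 0 <= (small k (N %/ i))%:R * (L i / i%:R) :> R.
  by rewrite mulr_ge0// divr_ge0// ln_nat_ge0.
have chain J : ((Q ^ J * y1) ^ 2 <= N)%N -> J%:R * (L N / (8 * k%:R)) <=
    \sum_((N %/ (Q ^ J * y1)).+1 <= i < (N %/ y1).+1) (small k (N %/ i))%:R * (L i / i%:R).
  elim: J => [|J IH] hJ; first by rewrite mul0r sumr_ge0.
  have Qe : (Q ^ J.+1 * y1 = Q * (Q ^ J * y1))%N by rewrite expnS mulnA.
  have QJ0 : (0 < Q ^ J * y1)%N by rewrite muln_gt0 expn_gt0 y10 ltnW.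
  have le1 : (Q ^ J * y1 <= Q ^ J.+1 * y1)%N by rewrite Qe leq_pmull// ltnW.
  rewrite (@big_cat_nat _ _ _ (N %/ (Q ^ J * y1)).+1)//=; first last.
  - by rewrite ltnS leq_div2l// leq_pmull// expn_gt0 ltnW.
  - by rewrite ltnS leq_div2l.
  rewrite -natr1 mulrDl mul1r addrC; apply: lerD.
    by apply: IH; apply: leq_trans hJ; rewrite leq_exp2r.
  rewrite Qe; apply: hb; last by rewrite -Qe.
  by rewrite leq_pmull// expn_gt0 ltnW.
pose J := Num.truncn (L N / (4 * L Q)).
have a0 : 0 <= L N / (4 * L Q) by rewrite divr_ge0 ?ln_nat_ge0 ?mulr_ge0 ?ltW.
have /andP[J1 J2] := truncn_itv a0; rewrite -/J in J1 J2.
have hJ : ((Q ^ J * y1) ^ 2 <= N)%N.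
  have q0 : (0 < Q ^ J * y1)%N by rewrite muln_gt0 expn_gt0 y10 ltnW.
  rewrite -(ler_nat R) -ler_ln ?posrE ?ltr0n ?expn_gt0 ?q0//.
  rewrite natrX lnXn ?ltr0n// natrM lnM ?posrE ?ltr0n ?expn_gt0 ?(ltnW Q1)//.
  rewrite natrX lnXn ?ltr0n ?(ltnW Q1)// -[L Q *+ J]mulr_natl -[_ *+ 2]mulr_natl.
  move: J1; rewrite ler_pdivlMr ?mulr_gt0//; lra.
apply: (@le_trans _ _ (J%:R * (L N / (8 * k%:R)))); last first.
  apply: le_trans (chain _ hJ) _.
  apply: ler_sum_subrange => //; first by rewrite ltnS leq_div2l// leq_pmull// expn_gt0 ltnW.
  by rewrite ltnS leq_div.
have -> : (64 * k%:R * L Q)^-1 * L N ^+ 2 = L N / (8 * L Q) * (L N / (8 * k%:R)).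
  by field; rewrite !gt_eqF.
apply: ler_wpM2r; first by rewrite divr_ge0 ?ln_nat_ge0 ?mulr_ge0 ?ltW.
have : 1 <= L N / (8 * L Q) by rewrite ler_pdivlMr ?mulr_gt0// mul1r.
have -> : L N / (8 * L Q) = L N / (4 * L Q) / 2 by field; rewrite gt_eqF.
by move: J2; rewrite -natr1; lra.
Qed.

(** The constant [1 / 2] must be sharp: it cancels the factor 2 of [psi_error_log_average_bound], so
    that averaging a bound [b] returns [b] to leading order. *)
Lemma sum_ln_div_le N : (0 < N)%N ->
  \sum_(1 <= i < N.+1) L i / i%:R <= L N ^+ 2 / 2 + L N.
Proof.
elim: N => // -[|N] IH _; first by rewrite big_nat1 ln1 !expr2 mul0r; lra.
rewrite (@big_nat1S R); have {}IH := IH isT.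
have h1 := lnS_ge R (ltn0Sn N); have h2 := lnS_le R (ltn0Sn N).
have h3 := ln_nat_ge0 R N.+1; have h5 := ln_nat_ge0 R N.+2.
have h4 : N.+1%:R^-1 <= 1 :> R by rewrite invf_le1 ?ltr0n// ler1n.
have h6 : 0 <= N.+2%:R^-1 :> R by rewrite invr_ge0.
move: IH h1 h2 h3 h4 h5 h6; move: (\sum_(_ <= _ < _) _) (L N.+2) (L N.+1) => s b a.
move: (N.+2%:R^-1) (N.+1%:R^-1) => u v IH h1 h2 h3 h4 h5 h6.
have p1 : b * u <= b * (b - a) by apply: ler_wpM2l; lra.
have p2 : (b - a) * (b - a) <= (b - a) * 1 by apply: ler_wpM2l; lra.
rewrite expr2 in IH *; lra.
Qed.

Definition eventual_psi_error_bound (b : R) : Prop :=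
  exists N0, forall n, (N0 <= n)%N -> `|err n| <= b * n%:R.

(** [k] is chosen so that [3 / k <= a / 2 <= b - a / 2]. Indices with small error thus save [a / 2]
    over the bound [b], and they carry a positive proportion of the weight. *)
Lemma psi_error_contraction (a : R) : 0 < a -> exists2 c : R, 0 < c &
  forall b, a <= b -> eventual_psi_error_bound b -> eventual_psi_error_bound (b - c).
Proof.
move=> a0; have [k' k'0 hk'] := nat_above (6 / a); pose k := k'.+1.
have k1 : (1 < k)%N by rewrite ltnS.
have kk : (0 : R) < k%:R by rewrite ltr0n.
have ka : 3 / k%:R <= a / 2.
  rewrite ler_pdivrMr//; move: hk'; rewrite ler_pdivrMr// => h.
  by rewrite /k -natr1; lra.
have [c c0 [N1 N10 hN1]] := small_psi_error_mass k1.
(* The saving is [a * c]; half of it is given up to absorb the lower-order terms. *)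
exists (a * c / 2); first by rewrite divr_gt0// mulr_gt0.
move=> b ab [N2 hN2].
(* Coefficient of [N * L N]: [2 * b] from [sum_ln_div_le], [16 * N2] from the quotients below [N2],
   where only Chebyshev's bound holds, and 240 from the remainder [120 * N * (1 + L N)]. *)
pose C : R := 2 * b + 16 * N2%:R + 240.
have C0 : 0 <= C by rewrite /C; have := ler0n R N2; lra.
have [N3 N30 hN3] := ln_nat_unbounded (Num.max 1 (2 * C / (a * c))).
exists (maxn N1 N3) => N; rewrite geq_max => /andP[NN1 NN3].
have N0 : (0 < N)%N by exact: leq_trans NN1.
have x0 : (0 : R) < N%:R by rewrite ltr0n.
have := hN3 _ NN3; rewrite ge_max ler_pdivrMr ?mulr_gt0// => /andP[l1 l2].
have pw i : (1 <= i < N.+1)%N -> L i * `|err (N %/ i)| <=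
   b * N%:R * (L i / i%:R) - a / 2 * N%:R * ((small k (N %/ i))%:R * (L i / i%:R))
   + 8 * N2%:R * L N.
  move=> /andP[i0 iN]; have ii : (0 : R) < i%:R by rewrite ltr0n.
  have -> : b * N%:R * (L i / i%:R) - a / 2 * N%:R * ((small k (N %/ i))%:R * (L i / i%:R))
     = L i * ((b - a / 2 * (small k (N %/ i))%:R) * (N%:R / i%:R)) by ring.
  have ls : L i <= L N by exact: ler_ln_nat.
  have Li := ln_nat_ge0 R i.
  have b'0 : a / 2 <= b - a / 2 * (small k (N %/ i))%:R.
    by case: (small _ _); rewrite /= ?mulr1 ?mulr0; lra.
  have Ni0 : 0 <= N%:R / i%:R :> R by rewrite divr_ge0.
  have MN := divn_le_div R N i.
  have [hM|hM] := leqP N2 (N %/ i)%N; last first.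
    apply: (@le_trans _ _ (8 * N2%:R * L N)).
      rewrite mulrC ler_pM//; apply: le_trans (psi_error_norm_le _ _) _.
      by rewrite ler_wpM2l// ler_nat ltnW.
    by rewrite lerDr mulr_ge0// mulr_ge0//; lra.
  apply: (@le_trans _ _ (L i * ((b - a / 2 * (small k (N %/ i))%:R) * (N%:R / i%:R)))); last first.
    by rewrite lerDl !mulr_ge0// ln_nat_ge0.
  apply: ler_wpM2l => //.
  apply: (@le_trans _ _ ((b - a / 2 * (small k (N %/ i))%:R) * (N %/ i)%:R)); last first.
    by apply: ler_wpM2l => //; lra.
  case E : (small k (N %/ i)); last by rewrite mulr0 subr0 hN2.
  rewrite mulr1; apply: le_trans E _; apply: ler_wpM2r => //; lra.
have S : \sum_(1 <= i < N.+1) L i * `|err (N %/ i)| <=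
   b * N%:R * (L N ^+ 2 / 2 + L N) - a / 2 * N%:R * (c * L N ^+ 2) + 8 * N2%:R * L N * N%:R.
  apply: (le_trans (ler_sum_nat pw)).
  rewrite big_split/= sum_nat1_const lerD2r sumrB -!mulr_sumr; apply: lerB.
    by rewrite ler_wpM2l ?sum_ln_div_le// mulr_ge0//; lra.
  by rewrite ler_wpM2l ?hN1// mulr_ge0//; lra.
have := psi_error_log_average_bound R N0.
move: S l1 l2; move: (\sum_(_ <= _ < _) _) (L N) (`|err N|) => s l E S l1 l2 hE.
have l0 : 0 < l by lra.
have h1 : E * l ^+ 2 <= N%:R * (b * l ^+ 2 - a * c * l ^+ 2 + C * l).
  apply: (le_trans hE); have : N%:R * 1 <= N%:R * l by rewrite ler_wpM2l.
  by rewrite /C; lra.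
have h2 : C * l <= a * c / 2 * l ^+ 2.
  by have := ler_wpM2r (ltW l0) l2; rewrite expr2; lra.
have h3 : E * l ^+ 2 <= (b - a * c / 2) * N%:R * l ^+ 2.
  apply: (le_trans h1); have := ler_wpM2l (ltW x0) h2; lra.
by rewrite -(ler_pM2r (exprn_gt0 2 l0)).
Qed.

Lemma prime_number_theorem_psi (eps : R) : 0 < eps -> eventual_psi_error_bound eps.
Proof.
move=> e0; apply: contrapT => noeps.
have mono b : eventual_psi_error_bound b -> eps <= b.
  move=> [N0 hb]; rewrite leNgt; apply/negP => be; apply: noeps; exists N0 => n Nn.
  by apply: le_trans (hb _ Nn) _; rewrite ler_wpM2r// ltW.
have [c c0 hc] := psi_error_contraction e0.
(* Starting from Chebyshev's bound 8, every contraction step gains c. *)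
have all_m m : eventual_psi_error_bound (8 - m%:R * c).
  elim: m => [|m IH]; first by exists 0%N => n _; rewrite mul0r subr0 psi_error_norm_le.
  have -> : 8 - m.+1%:R * c = 8 - m%:R * c - c by rewrite -natr1; ring.
  by apply: hc => //; exact: mono.
have [m _ hm] := nat_above (8 / c).
have := mono _ (all_m m); move: hm; rewrite ler_pdivrMr//; lra.
Qed.

End PNT.

(** * RPR-primes and the prime counting function *)

(** [p] itself passes the filter, so the default of [head] is not reached. *)
Lemma q_of_spec p : prime p -> prime (q_of p) && (p < (q_of p).*2)%N.
Proof.
move=> pp; rewrite /q_of; set s := [seq _ <- _ | _].
have ps : p \in s.
  by rewrite mem_filter pp mem_iota ltnS leqnn -addnn -ltn_subLR// subnn prime_gt0.
have : head p.+1 s \in s by case: s ps => // a s _; exact: mem_head.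
by rewrite mem_filter => /andP[].
Qed.

Lemma non_rpr_next p p' : prime p -> ~~ rpr_prime p -> prime p' -> (p < p')%N ->
  ((q_of p).*2 <= p')%N.
Proof.
move=> pp; rewrite /rpr_prime pp/= => /hasPn h pp' pp'lt.
rewrite leqNgt; apply/negP => lt; have := h p'.
by rewrite mem_iota/= add0n => /(_ lt); rewrite pp' pp'lt lt.
Qed.

(** [q_of] is strictly increasing on the non-RPR primes, so those with [q_of p <= n %/ 2] inject
    into the primes up to [n %/ 2]. *)
Lemma prime_pi_le_rpr_pi n :
  (prime_pi n <= rpr_pi n + (prime_pi (n %/ 2) + 1))%N.
Proof.
pose bad p := prime p && ~~ rpr_prime p.
have -> : prime_pi n = (rpr_pi n + count bad (iota 0 n.+1))%N.
  rewrite /prime_pi /rpr_pi -!sum1_count (bigID rpr_prime)/=; congr (_ + _)%N.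
  by apply: eq_bigl => p; rewrite /rpr_prime; case: (prime p).
rewrite leq_add2l; pose s := [seq p <- iota 0 n.+1 | bad p].
have us : uniq s by rewrite filter_uniq// iota_uniq.
have sP p : p \in s -> [/\ prime p, ~~ rpr_prime p & (p <= n)%N].
  by rewrite mem_filter mem_iota ltnS => /andP[/andP[-> ->]].
have lt_q p p' : p \in s -> p' \in s -> (p < p')%N -> (q_of p < q_of p')%N.
  move=> /sP[pp np _] /sP[pp' _ _] lt; have := non_rpr_next pp np pp' lt.
  have /andP[_] := q_of_spec pp'; lia.
rewrite -size_filter -/s; clearbody s; rewrite -(count_predC (fun p => q_of p <= n %/ 2)%N s).
rewrite -!size_filter; apply: leq_add.
  rewrite -(size_map q_of) /prime_pi -size_filter; apply: uniq_leq_size.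
    rewrite map_inj_in_uniq; first exact: filter_uniq.
    move=> p p'.
    rewrite !mem_filter => /andP[_ ps] /andP[_ p's] eq.
    by case: (ltngtP p p') => // /lt_q lt; have := lt ltac:(done) ltac:(done); rewrite eq ltnn.
  move=> q /mapP[p]; rewrite mem_filter => /andP[qn /sP[pp _ _]] ->.
  by rewrite mem_filter mem_iota ltnS qn; have /andP[-> _] := q_of_spec pp.
set t := [seq _ <- _ | _].
have ut : uniq t by exact: filter_uniq.
case E : t => [//|p t']; rewrite -E; apply: (@uniq_leq_size _ t [:: p]) => // p' p't.
have pt : p \in t by rewrite E mem_head.
(* At most one exception: if [a < b <= n], then [(q_of a).*2 <= b <= n], contrary to
   [q_of a > n %/ 2]. *)
have key a b : a \in t -> b \in t -> ~~ (a < b)%N.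
  rewrite !mem_filter/= => /andP[]; rewrite -ltnNge => an /sP[pa na _] /andP[_ /sP[pb _ bn]].
  apply/negP => /(non_rpr_next pa na pb); have := ltn_ceil n (isT : (0 < 2)%N); lia.
by rewrite inE; have := key _ _ pt p't; have := key _ _ p't pt; case: ltngtP.
Qed.

Section PrimePi.
Variable R : realType.
Local Notation Lam := (@vonMangoldt R).
Local Notation psi := (@chebyshev_psi R).
Local Notation L n := (@ln R n%:R).
Implicit Types (n m d e p N M y k K : nat).

(** * From [psi] to the prime counting function *)

Lemma prime_pi_sum N : (prime_pi N)%:R = \sum_(1 <= n < N.+1) (prime n)%:R :> R.
Proof.
rewrite /prime_pi -sum1_count big_mkcond/= natr_sum -[RHS]add0r.
by rewrite big_cons /index_iota subn1.
Qed.

(** A prime [p] contributes [L p] once for each power [p ^ i <= N], that is [trunc_log p N] times,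
    hence at most [L N] in all. *)
Lemma psi_le_prime_pi N : (0 < N)%N -> psi N <= (prime_pi N)%:R * L N.
Proof.
move=> N0.
have h n : (0 < n <= N)%N -> Lam n <=
    \sum_(1 <= p < N.+1) \sum_(1 <= i < N.+1) (prime p && (n == p ^ i)%N)%:R * L p.
  move=> /andP[n0 nN].
  have pos p i : 0 <= (prime p && (n == p ^ i)%N)%:R * L p.
    by rewrite mulr_ge0// ln_nat_ge0.
  rewrite {1}/vonMangoldt; case E : (primes n) => [|p [|? ?]]; try by do 2!apply: sumr_ge0 => ? _.
  have pin : p \in primes n by rewrite E mem_head.
  have [pp _ pn] : [/\ prime p, (0 < n)%N & (p %| n)%N] by apply/and3P; rewrite -mem_primes.
  have nE : n = (p ^ logn p n)%N.
    rewrite -p_part part_pnat_id//; apply/pnatP => // q qp qn.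
    have : q \in primes n by rewrite mem_primes qp n0.
    by rewrite E inE => /eqP ->; rewrite inE/=.
  have l0 : (0 < logn p n)%N by rewrite logn_gt0.
  have lN : (logn p n < N.+1)%N.
    by rewrite ltnS; apply: leq_trans nN; apply: ltnW; rewrite {2}nE ltn_expl// prime_gt1.
  have pN : (0 < p < N.+1)%N.
    by rewrite prime_gt0//= ltnS (leq_trans _ nN)// dvdn_leq.
  rewrite (bigD1_seq p) ?iota_uniq ?mem_index_iota//=.
  rewrite (bigD1_seq (logn p n)) ?iota_uniq ?mem_index_iota ?l0//=.
  rewrite pp -nE eqxx mul1r -addrA lerDl addr_ge0//.
    by apply: sumr_ge0 => i _; rewrite mulr_ge0// ln_nat_ge0.
  by apply: sumr_ge0 => q _; exact: sumr_ge0.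
apply: (@le_trans _ _ (\sum_(1 <= n < N.+1)
   \sum_(1 <= p < N.+1) \sum_(1 <= i < N.+1) (prime p && (n == p ^ i)%N)%:R * L p)).
  by apply: ler_sum_nat => n nN; exact: h.
rewrite prime_pi_sum mulr_suml (exchange_big_dep_nat xpredT)//=.
apply: ler_sum_nat => p /andP[p0 pN].
rewrite (exchange_big_dep_nat xpredT)//=.
have [pp|] := boolP (prime p); last first.
  move=> _; rewrite [X in _ <= X]mul0r big1// => i _.
  by rewrite big1// => n _; rewrite mul0r.
rewrite [X in _ <= X]mul1r; have p1 := prime_gt1 pp.
apply: (@le_trans _ _ (\sum_(1 <= i < N.+1) (i <= trunc_log p N)%N%:R * L p)).
  apply: ler_sum_nat => i /andP[i0 _]; rewrite -mulr_suml ler_wpM2r ?ln_nat_ge0//.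
  have [iN|iN] := leqP i (trunc_log p N).
    have pi0 : (0 < p ^ i)%N by rewrite expn_gt0 p0.
    have [piN|piN] := leqP (p ^ i) N; last first.
      rewrite big_nat_cond big1// => n /andP[/andP[_ nN] _].
      by rewrite /= ltn_eqF//; exact: leq_trans nN piN.
    rewrite (bigD1_seq (p ^ i)%N) ?iota_uniq ?mem_index_iota ?pi0//=.
    by rewrite eqxx big1 ?addr0// => n /negbTE ->.
  rewrite big_nat_cond big1// => n /andP[/andP[_ nN] _].
  rewrite /= ltn_eqF//; apply: leq_ltn_trans (_ : N < _)%N => //.
  apply: leq_trans (trunc_log_ltn N p1) _; by rewrite leq_exp2l.
rewrite -mulr_suml; apply: (@le_trans _ _ ((trunc_log p N)%:R * L p)).
  rewrite ler_wpM2r ?ln_nat_ge0//.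
  have tN : (trunc_log p N <= N)%N.
    by apply: leq_trans (trunc_logP p1 N0); apply: ltnW; exact: ltn_expl.
  rewrite (@big_cat_nat _ _ _ (trunc_log p N).+1)//= [X in _ + X]big_nat_cond.
  rewrite [X in _ + X]big1; last first.
    by move=> i /andP[/andP[+ _] _]; rewrite ltnNge => /negbTE ->.
  rewrite addr0 -[X in _ <= X]mul1r -sum_nat1_const; apply: ler_sum => i _.
  by case: (_ <= _)%N.
rewrite mulr_natl -lnXn ?ltr0n// -natrX ler_ln_nat//.
exact: trunc_logP.
Qed.

(** Indices up to [K] are counted trivially; a prime above [K] contributes at least [L K] to
    [psi M]. *)
Lemma prime_pi_le_psi M K : (prime_pi M)%:R * L K <= K%:R * L K + psi M.
Proof.
rewrite prime_pi_sum mulr_suml.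
apply: (@le_trans _ _ (\sum_(1 <= n < M.+1) ((n <= K)%N%:R * L K + Lam n))).
  apply: ler_sum_nat => n /andP[n0 _]; have LK := ln_nat_ge0 R K.
  have [nK|Kn] := leqP n K.
    rewrite mul1r; apply: (@le_trans _ _ (L K)); last by rewrite lerDl vonMangoldt_ge0.
    by case: (prime n); rewrite ?mul1r// mul0r.
  rewrite mul0r add0r; have [pn|_] := boolP (prime n).
    by rewrite mul1r vonMangoldt_prime// ler_ln_nat// ltnW.
  by rewrite mul0r vonMangoldt_ge0.
rewrite big_split/= lerD2r -mulr_suml ler_wpM2r ?ln_nat_ge0//.
have -> : \sum_(1 <= n < M.+1) (n <= K)%N%:R =
    (count (fun n => n <= K)%N (index_iota 1 M.+1))%:R :> R.
  rewrite -sum1_count natr_sum [RHS]big_mkcond; apply: eq_bigr => n _.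
  by case: leqP.
rewrite ler_nat -size_filter -[X in (_ <= X)%N](size_iota 1); apply: uniq_leq_size.
  by rewrite filter_uniq// iota_uniq.
move=> n; rewrite mem_filter mem_index_iota mem_iota add1n ltnS.
by rewrite ltnS => /and3P[-> ->].
Qed.

Lemma prime_pi_half_le (eps : R) : 0 < eps ->
  exists N0, forall N, (N0 <= N)%N ->
    (prime_pi (N %/ 2))%:R + 1 <= (1 / 2 + eps) * (prime_pi N)%:R :> R.
Proof.
move=> e0; pose h : R := Num.min (1 / 4) (eps / 10).
have h0 : 0 < h by rewrite lt_min !divr_gt0.
have h14 : h <= 1 / 4 by rewrite ge_min lexx.
have h10 : 10 * h <= eps.
  suff : h <= eps / 10 by lra.
  by rewrite ge_min lexx orbT.
have [N1 hN1] := prime_number_theorem_psi h0.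
(* [4 / h ^+ 3] is what [2 / (h ^+ 2 * L N) <= h / 2] requires below. *)
have [N2 _ hN2] := ln_nat_unbounded (Num.max 1 (4 / h ^+ 3)).
have h40 : 0 < h / 4 by rewrite divr_gt0.
have [N3 _ hN3] := ln_nat_le_eps h40.
exists (maxn (2 * N1) (maxn N2 (maxn N3 1))) => N.
rewrite !geq_max => /and4P[NN1 NN2 NN3 N0].
have psiN : (1 - h) * N%:R <= psi N.
  have : `|psi_error N| <= h * N%:R by apply: hN1; lia.
  by rewrite /psi_error ler_norml; lra.
have psiM : psi (N %/ 2)%N <= (1 + h) * N%:R / 2.
  have : `|psi_error (N %/ 2)| <= h * (N %/ 2)%:R :> R.
    by apply: hN1; rewrite leq_divRL// mulnC.
  have := ler_wpM2l (ltW h0) (divn_le_div R N 2); have := divn_le_div R N 2.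
  by rewrite /psi_error ler_norml; lra.
have x0 : (0 : R) < N%:R by rewrite ltr0n.
have := hN2 _ NN2; rewrite ge_max ler_pdivrMr ?exprn_gt0// => /andP[l1 l2].
have l3 := hN3 _ NN3.
have l0 : 0 < L N by lra.
(* [K] is about [N] to the power [1 - h]: its logarithm is nearly [L N], yet [K * L N] is negligible
   against [N], because [expR t >= t ^+ 2 / 2] at [t = h * L N]. *)
pose K := (Num.truncn (expR ((1 - h) * L N))).+1.
have KL : (1 - h) * L N <= L K.
  rewrite -ler_expR lnK ?posrE ?ltr0n// ltW//; exact: truncnS_gt.
have Ku : (K%:R + 1) * L N <= h * N%:R.
  have : K%:R <= 1 + N%:R * (2 / (h * L N) ^+ 2).
    rewrite /K -natr1 addrC lerD2l; apply: (@le_trans _ _ (expR ((1 - h) * L N))).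
      by rewrite truncn_le expR_ge0.
    have -> : (1 - h) * L N = L N - h * L N by ring.
    rewrite expRB lnK ?posrE//; apply: ler_wpM2l; first exact: ltW.
    have hl0 : 0 < h * L N by rewrite mulr_gt0.
    rewrite -[X in _ <= X]invrK lef_pV2 ?posrE ?expR_gt0 ?invr_gt0 ?divr_gt0 ?exprn_gt0//.
    have := expR_ge1Dxn 1 (ltW hl0); rewrite invf_div/=.
    have -> : (2`!)%:R = 2 :> R by [].
    lra.
  move=> /(ler_wpM2r (ltW l0)) hK.
  have e1 : N%:R * (2 / (h * L N) ^+ 2) * L N <= N%:R * (h / 2).
    rewrite -mulrA ler_pM2l//.
    have -> : 2 / (h * L N) ^+ 2 * L N = 2 / (h ^+ 2 * L N) by field; rewrite !gt_eqF.
    rewrite ler_pdivrMr ?mulr_gt0 ?exprn_gt0//.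
    by move: l2; rewrite !exprS expr0; lra.
  move: hK; rewrite !mulrDl; lra.
have K1 := prime_pi_le_psi (N %/ 2) K.
have P1 := psi_le_prime_pi N0.
move: (psi _) (psi _) psiN psiM K1 P1 => v u.
have lk0 : 0 < L K by apply: lt_le_trans KL; apply: mulr_gt0 => //; lra.
move: (prime_pi _)%:R (prime_pi N)%:R => p q psiN psiM K1 P1.
have p1 : p <= K%:R + v / L K.
  by rewrite -(ler_pM2r lk0) mulrDl divfK ?gt_eqF.
have v1 : v / L K * L N <= (1 / 2 + 2 * h) * N%:R.
  rewrite mulrAC ler_pdivrMr//.
  apply: (@le_trans _ _ ((1 + h) * N%:R / 2 * L N)); first by rewrite ler_wpM2r// ltW.
  apply: (@le_trans _ _ ((1 / 2 + 2 * h) * N%:R * ((1 - h) * L N))); last first.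
    by apply: ler_wpM2l => //; rewrite mulr_ge0//; lra.
  have : 0 <= h * (1 - 2 * h) * (N%:R * L N) by rewrite !mulr_ge0//; lra.
  lra.
rewrite -(ler_pM2r l0).
have f1 : (p + 1) * L N <= (1 / 2 + 3 * h) * N%:R.
  have := ler_wpM2r (ltW l0) p1; rewrite mulrDl => f.
  move: Ku; rewrite !mulrDl; lra.
apply: (le_trans f1); rewrite -mulrA.
(* It remains to see [1 / 2 + 3 * h <= (1 / 2 + eps) * (1 - h)], which the choice of [h] ensures. *)
apply: (@le_trans _ _ ((1 / 2 + eps) * ((1 - h) * N%:R))); last first.
  by apply: ler_wpM2l; [lra|exact: le_trans P1].
have : 0 <= (eps - 10 * h) * (3 / 4) * N%:R by rewrite !mulr_ge0//; lra.
have : 0 <= eps * (1 / 4 - h) * N%:R by rewrite !mulr_ge0//; lra.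
have : 0 <= h * N%:R by rewrite mulr_ge0//; lra.
lra.
Qed.

(** The lower limit is the supremum of the tail infima, and the infimum from [N0] on is already at
    least [x - eps]. *)
Lemma lee_limn_einf (u : nat -> \bar R) (x : R) :
  (forall eps, 0 < eps -> exists N0, forall n, (N0 <= n)%N -> ((x - eps)%:E <= u n)%E) ->
  (x%:E <= limn_einf u)%E.
Proof.
move=> h; rewrite limn_einf_lim (cvg_lim _ (@cvg_einfs_sup _ u))//.
apply/lee_addgt0Pr => e e0; have [N0 hN0] := h _ e0.
rewrite -leeBlDr// -EFinB; apply: (@le_trans _ _ (einfs u N0)).
  by apply: le_ereal_inf_tmp => _ [n /= Nn <-]; exact: hN0.
by apply: ereal_sup_ubound; exists N0.
Qed.

End PrimePi.

Theorem theorem2 (R : realType) :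
  ((1 / 2 : R)%:E <= limn_einf (fun n : nat => ((rpr_pi n)%:R / (prime_pi n)%:R : R)%:E))%E.
Proof.
apply: lee_limn_einf => eps e0; have [N0 hN0] := prime_pi_half_le e0.
(* From [n = 2] on [prime_pi n] is positive, so the quotient is a genuine one. *)
exists (maxn N0 2) => n; rewrite geq_max lee_fin => /andP[Nn n2].
have p0 : (0 : R) < (prime_pi n)%:R.
  rewrite ltr0n /prime_pi -has_count; apply/hasP; exists 2%N => //.
  by rewrite mem_iota ltnS n2.
rewrite ler_pdivlMr//.
have := prime_pi_le_rpr_pi n; rewrite -(ler_nat R).
rewrite [(rpr_pi n + _)%:R]natrD [(prime_pi (n %/ 2) + 1)%:R]natrD.
have := hN0 _ Nn; move: (prime_pi _)%:R (prime_pi n)%:R (rpr_pi n)%:R => a b c; lra.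
Qed.
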